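(* Let $c>0$ and let $G=G^{(n)}$ be a uniform Cooper-Frieze random graph with parameters $c$ and $n$, $n\in\mathbb{N}$. Then root estimation is possible in $G$ (i.e. for the sequence $\{G^{(n)}\}_{n\ge1}$). Moreover, there exist constants $c_0,c_1>0$ depending only on $c$ such that the confidence set sizes $K(\epsilon)$ in the definition of root estimation may be chosen so that, for all $\epsilon\in(0,1)$, \[ K(\epsilon)\le c_0\bigl(\log(1/\epsilon)\bigr)^{c_1\log(1/\epsilon)} . \]
   Context: Write $[n]=\{1,\dots,n\}$. Uniform random recursive tree on $[n]$: the random tree in which, independently for each $i\in\{2,3,\dots,n\}$, vertex $i$ is attached by an (undirected) edge to a vertex chosen uniformly at random from $\{1,\dots,i-1\}$. Uniform Cooper-Frieze random graph with parameters $c>0$ and $n\in\mathbb{N}$: let $G_1=([n],E_1)$ be a uniform random recursive tree on $[n]$. Let $G_2=([n],E_2)$ be a random graph, independent of $G_1$, whose edges are present independently of each other, with, for all $i\ne j$, \[ \mathbb{P}\{(i,j)\in E_2\}=\min\left(\frac{c}{\max(i,j)-1},1\right). \] The uniform Cooper-Frieze random graph is the simple undirected graph $G=([n],E_1\cup E_2)$. Root estimation: let $\{G^{(n)}\}_{n\ge1}$ be a sequence of random graphs such that $G^{(n)}$ has vertex set $[n]$. Root estimation is possible if for every $\epsilon\in(0,1)$ there is a positive integer $K(\epsilon)$, not depending on $n$, such that for every $n\in\mathbb{N}$, upon observing $G^{(n)}$ without its vertex labels, one may find a set $S\subset[n]$ of at most $K(\epsilon)$ vertices with $\mathbb{P}\{1\in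 S\}\ge 1-\epsilon$. Here ''observing the graph without the vertex labels'' means that $S=S(G^{(n)})$ for a rule $S(\cdot)$ (which may depend on $n$, $\epsilon$ and the model parameters) that assigns to each graph $H$ on $[n]$ a subset $S(H)\subset[n]$ and does not depend on the labeling: $S(\pi H)=\pi(S(H))$ for every permutation $\pi$ of $[n]$, where $\pi H$ is the graph obtained from $H$ by relabeling its vertices by $\pi$. *)

(* Defs.v *)
From HB Require Import structures.
From mathcomp Require Import all_boot all_order all_algebra all_fingroup.
From mathcomp Require Import all_classical all_reals all_analysis.

Set Implicit Arguments.
Unset Strict Implicit.
Unset Printing Implicit Defensive.

Import Order.TTheory GRing.Theory Num.Theory.

Local Open Scope classical_set_scope.
Local Open Scope ring_scope.

(* Vertex labels are shifted down by one: the vertex labelled k in {1,...,n} is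
   the element of 'I_n of value k - 1, so the root (label 1) is ord0, and the
   quantity max(i,j) - 1 of the labels is maxn of the values. *)

(* A simple undirected graph on 'I_n is identified with its set of edges, an
   edge being an unordered pair of distinct vertices. *)
Definition edge_set (n : nat) := {set {set 'I_n}}.

Definition simple_graph (n : nat) (E : edge_set n) : Prop :=
  forall e : {set 'I_n}, e \in E -> #|e| = 2%N.

Definition relabel (n : nat) (pi : {perm 'I_n}) (E : edge_set n) : edge_set n :=
  imset (fun e : {set 'I_n} => imset pi (mem e)) (mem E).

Section Probability.
Context {R : realType} {d : measure_display} {T : measurableType d}.
Variable P : probability T R.

(* All the values below lie in finite types, which carry the discrete
   sigma-algebra. *)
Definition random_element (V : Type) (X : T -> V) : Prop :=
  forall B : set V, measurable (X @^-1` B).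

Definition mutually_independent_events (I : finType) (D : {set I})
    (A : I -> set T) : Prop :=
  forall J : {set I}, J \subset D ->
    P (\bigcap_(i in [set` J]) A i) = (\prod_(i in J) P (A i))%E.

Definition mutually_independent (I : finType) (D : {set I}) (V : Type)
    (X : I -> T -> V) : Prop :=
  forall B : I -> set V,
    mutually_independent_events D (fun i => X i @^-1` B i).

Definition independent_pair (U V : Type) (X : T -> U) (Y : T -> V) : Prop :=
  forall (A : set U) (B : set V),
    P ((X @^-1` A) `&` (Y @^-1` B)) = (P (X @^-1` A) * P (Y @^-1` B))%E.

(* X i is the vertex to which i is attached; X i is irrelevant for the root,
   i = 0. There are i vertices of value less than i. *)
Definition uniform_random_recursive_tree (n : nat) (G : T -> edge_set n) :
    Prop :=
  exists X : 'I_n -> T -> 'I_n,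
    [/\ forall i, random_element (X i),
        mutually_independent [set i : 'I_n | (0 < i)%N]%SET X,
        forall (i : 'I_n) (w : T), (0 < i)%N -> (X i w < i)%N,
        forall i j : 'I_n, (j < i)%N ->
          P [set w | X i w = j] = ((i%:R : R)^-1)%:E &
        forall w, G w =
          [set [set i; X i w]%SET | i in [set i : 'I_n | (0 < i)%N]%SET]%SET].

Definition cooper_frieze_extra_edges (c : R) (n : nat) (G : T -> edge_set n) :
    Prop :=
  [/\ random_element G,
      forall w, simple_graph (G w),
      mutually_independent_events [set e : {set 'I_n} | #|e| == 2%N]%SET
        (fun e => [set w | e \in G w]) &
      forall i j : 'I_n, i != j ->
        P [set w | [set i; j]%SET \in G w] =
          (Num.min (c / (maxn i j)%:R) 1)%:E].

Definition uniform_cooper_frieze (c : R) (n : nat) (G : T -> edge_set n) :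
    Prop :=
  exists G1 G2 : T -> edge_set n,
    [/\ uniform_random_recursive_tree G1,
        cooper_frieze_extra_edges c G2,
        independent_pair G1 G2 &
        forall w, G w = (G1 w :|: G2 w)%SET].

End Probability.

(* S is a vertex-set rule that does not see the labels. *)
Definition label_free (n : nat) (S : edge_set n -> {set 'I_n}) : Prop :=
  forall (H : edge_set n) (pi : {perm 'I_n}), simple_graph H ->
    S (relabel pi H) = imset pi (mem (S H)).

(* There is a confidence set for the root, of at most k vertices and of error
   probability at most eps, computed from the unlabelled graph. *)
Definition root_confidence_set (R : realType) (d : measure_display)
    (T : measurableType d) (P : probability T R) (n : nat)
    (G : T -> edge_set n.+1) (eps : R) (k : nat) : Prop :=
  exists S : edge_set n.+1 -> {set 'I_n.+1},
    [/\ label_free S,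
        forall H, simple_graph H -> (#|S H| <= k)%N &
        ((1 - eps)%:E <= P [set w | ord0 \in S (G w)])%E].

(* The member of index m of the sequence is a random graph on m.+1 vertices;
   K eps is the size bound, uniform in m. *)
Definition root_estimation_with (R : realType) (d : nat -> measure_display)
    (T : forall m, measurableType (d m)) (P : forall m, probability (T m) R)
    (G : forall m, T m -> edge_set m.+1) (K : R -> nat) : Prop :=
  forall eps : R, 0 < eps < 1 ->
    (0 < K eps)%N /\ forall m, root_confidence_set (P m) (@G m) eps (K eps).

Definition root_estimation_possible (R : realType) (d : nat -> measure_display)
    (T : forall m, measurableType (d m)) (P : forall m, probability (T m) R)
    (G : forall m, T m -> edge_set m.+1) : Prop :=
  exists K : R -> nat, root_estimation_with P G K.

(* Main.v *)
Require Import Defs.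
From mathcomp Require Import all_boot all_order all_algebra all_fingroup.
From mathcomp Require Import all_classical all_reals all_analysis.
From mathcomp Require Import zify ring lra.
Set Implicit Arguments.
Unset Strict Implicit.
Unset Printing Implicit Defensive.
Import Order.TTheory GRing.Theory Num.Theory.
Local Open Scope ring_scope.

(** The confidence set consists of the vertices carrying a short theta: the
    vertices v for which some w (possibly v itself) is joined to v by three
    pairwise edge-disjoint trails of length at most s, the first two of them
    nonempty.  When w = v and the third trail is empty this is a figure eight
    centred at v.  Being defined by the graph alone, the rule is label-free; to
    bound its size it returns the empty set when there are more than K such
    vertices.

    Few vertices carry a short theta.  Each edge {i, j} appears with probability
    at most (1 + c) / max(i, j), and for distinct edges these bounds multiply:
    the tree edges are determined by independent parents, and two different
    tree edges whose larger endpoints coincide exclude each other.  So the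
    expected number of thetas is at most a sum of products of walk weights for
    the kernel (1 + c) / max(i, j) ([pr_theta_trails]).  The weight
    g(j) = (j + 1)^(-1/2) satisfies 1 / (max(i, j) + 1) <= g(i) g(j) and is
    multiplied by at most 4 under the kernel 1 / (max(i, j) + 1), whence walks of
    length t >= 1 from v to w have total weight at most C^t g(v) g(w)
    ([walk_weight_le]).  Since the sum of g(v)^3 converges, the expected number
    of vertices carrying a theta is at most 9 (8 C^3)^s, uniformly in the number
    of vertices ([sum_pr_theta_le]).

    The root carries a theta of size s = 7k except with probability
    exponentially small in k ([pr_no_theta_root]).  Among the vertices of
    (2^k, 2^(2k)], and among those of (2^(2k), 2^(3k)], at least one is joined to
    the root by an extra edge, except with probability exp(- min(c, 1) k / 2) for
    each block.  Tree paths from vertices below 2^(3k) to the root have fewer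
    than 7k edges except with probability 4 / 2^k, and no extra edge to the root
    beyond 2^k is parallel to a tree edge except with probability c / 2^k.
    Otherwise the two extra edges, followed by the two tree paths up to the place
    where they merge at w, and the tree path from w to the root, form a theta
    ([theta_root]).

    With k proportional to log (1 / eps), Markov's inequality gives a set size
    that is even polynomial in 1 / eps.  A bound e^(B L) with L = log (1 / eps) is
    at most e^B L^(B L), because L <= 1 + L log L ([expR_le_powR_self]). *)

(** * The kernel 1 / max(i, j) and the weight of walks *)

Section Sums.
Variable R : realType.

(** The shift by one keeps the weight finite at the root, whose value is 0. *)
Definition rsqrt (j : nat) : R := (Num.sqrt j.+1%:R)^-1.

Lemma rsqrt_gt0 j : 0 < rsqrt j.
Proof. by rewrite invr_gt0 sqrtr_gt0. Qed.

Lemma rsqrt_sqr j : rsqrt j ^+ 2 = j.+1%:R^-1.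
Proof. by rewrite exprVn sqr_sqrtr. Qed.

Lemma rsqrt_le1 j : rsqrt j <= 1.
Proof. by rewrite invf_le1 ?sqrtr_gt0 // -[leLHS]sqrtr1 ler_wsqrtr // ler1n. Qed.

(** Comparison with the telescoping sum of 2 (sqrt (j + 1) - sqrt j). *)
Lemma sum_rsqrt i : \sum_(0 <= j < i.+1) rsqrt j <= 2 * Num.sqrt i.+1%:R.
Proof.
have step j : rsqrt j <= 2 * (Num.sqrt j.+1%:R - Num.sqrt j%:R).
  rewrite /rsqrt; set y := Num.sqrt _; set x := Num.sqrt _.
  have y0 : 0 < y by rewrite sqrtr_gt0.
  have yx : y ^+ 2 = x ^+ 2 + 1 by rewrite !sqr_sqrtr // -natr1.
  rewrite -[leLHS]mul1r ler_pdivrMr //.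
  have := sqr_ge0 (y - x); nra.
apply: le_trans (ler_sum _ (fun j _ => step j)) _.
by rewrite -mulr_sumr telescope_sumr // sqrtr0 subr0.
Qed.

(** Comparison with the telescoping sum of 2 / sqrt j - 2 / sqrt (j + 1). *)
Lemma sum_rsqrt_cube i n : (0 < i <= n)%N ->
  \sum_(i <= j < n) rsqrt j / j.+1%:R <= 2 / Num.sqrt i%:R.
Proof.
move=> /andP[i_gt0 i_le].
pose f j : R := - (2 / Num.sqrt j%:R).
have step j : (i <= j < n)%N -> rsqrt j / j.+1%:R <= f j.+1 - f j.
  move=> /andP[ij _]; rewrite /rsqrt /f; set y := Num.sqrt j.+1%:R; set x := Num.sqrt j%:R.
  have y0 : 0 < y by rewrite sqrtr_gt0.
  have x0 : 0 < x by rewrite sqrtr_gt0 ltr0n (leq_trans i_gt0).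
  have yx : y ^+ 2 = x ^+ 2 + 1 by rewrite !sqr_sqrtr // -natr1.
  have -> : j.+1%:R = y ^+ 2 :> R by rewrite sqr_sqrtr.
  have xy : x <= y by rewrite ler_wsqrtr // ler_nat.
  rewrite -subr_ge0.
  have -> : - (2 / y) - - (2 / x) - y^-1 / y ^+ 2 =
            (2 * y ^+ 2 * (y - x) - x) / (x * y ^+ 3).
    by field; rewrite !lt0r_neq0.
  apply: divr_ge0; last by rewrite mulr_ge0 ?exprn_ge0 // ltW.
  rewrite subr_ge0.
  have E : (y - x) * (y + x) = 1 by rewrite -subr_sqr yx; ring.
  have D0 : 0 <= y - x by rewrite subr_ge0.
  have : x * (y - x) * (y + x) <= 2 * y ^+ 2 * (y - x).
    rewrite mulrAC ler_wpM2r //.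
    nra.
  by rewrite -mulrA E mulr1.
apply: le_trans (ler_sum_nat step) _.
by rewrite telescope_sumr // /f opprK gerDr oppr_le0 divr_ge0 // sqrtr_ge0.
Qed.

(** This is Schur's test for the kernel 1 / max(i, j): its test function is
    (j + 1)^(-1/2), and the ranges j <= i and j > i contribute at most
    2 (i + 1)^(-1/2) each. *)
Lemma kernel_rsqrt i n :
  \sum_(0 <= j < n) rsqrt j / (maxn i j).+1%:R <= 4 * rsqrt i.
Proof.
have pos j : 0 <= rsqrt j / (maxn i j).+1%:R.
  by rewrite divr_ge0 // ltW // rsqrt_gt0.
have -> : 4 * rsqrt i = 2 * rsqrt i + 2 * rsqrt i by ring.
apply: (@le_trans _ _ (\sum_(0 <= j < n + i.+1) rsqrt j / (maxn i j).+1%:R)).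
  rewrite [leRHS](big_cat_nat (n := n)) ?leq_addr //=.
  by rewrite lerDl sumr_ge0.
rewrite (big_cat_nat (n := i.+1)) ?leq_addl //=; apply: lerD.
  have -> : \sum_(0 <= j < i.+1) rsqrt j / (maxn i j).+1%:R =
            (\sum_(0 <= j < i.+1) rsqrt j) / i.+1%:R.
    rewrite mulr_suml; apply: eq_big_nat => j /andP[_ ji].
    by rewrite (maxn_idPl _).
  rewrite ler_pdivrMr // (le_trans (sum_rsqrt i)) // -mulrA ler_pM2l //.
  have s0 : Num.sqrt i.+1%:R != 0 :> R by rewrite lt0r_neq0 // sqrtr_gt0.
  have sE := @sqr_sqrtr R i.+1%:R (ler0n _ _).
  by rewrite /rsqrt; move: (Num.sqrt _) s0 sE => y s0 <-; rewrite expr2 mulKf.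
apply: le_trans (sum_rsqrt_cube (n := n + i.+1) _); last by rewrite leq_addl.
rewrite le_eqVlt; apply/orP; left; apply/eqP/eq_big_nat => j /andP[ij _].
by rewrite (maxn_idPr _) // ltnW.
Qed.

Lemma sum_rsqrt3 n : \sum_(0 <= j < n) rsqrt j ^+ 3 <= 3.
Proof.
case: n => [|n]; first by rewrite big_geq.
rewrite big_nat_recl //= {1}/rsqrt sqrtr1 invr1 expr1n.
have -> : 3 = 1 + 2 :> R by ring.
rewrite lerD2l.
have := @sum_rsqrt_cube 1 n.+1 isT; rewrite sqrtr1 divr1 big_add1 /=.
apply: le_trans; apply: ler_sum => j _.
by rewrite exprSr exprS expr1 -rsqrt_sqr expr2 mulrA.
Qed.

Lemma sum_inv_sqr m n : (0 < m)%N ->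
  \sum_(m.+1 <= j < n) (j%:R ^+ 2)^-1 <= m%:R^-1 :> R.
Proof.
move=> m_gt0; have [nm|mn] := leqP n m.+1; first by rewrite big_geq ?invr_ge0.
pose f j : R := - (j.-1%:R)^-1.
have step j : (m.+1 <= j < n)%N -> (j%:R ^+ 2)^-1 <= f j.+1 - f j.
  case: j => // j /andP[mj _]; rewrite /f /= opprK.
  have j0 : 0 < j%:R :> R by rewrite ltr0n (leq_trans m_gt0).
  rewrite -natr1; set x : R := j%:R in j0 *.
  have x10 : 0 < x + 1 by rewrite ltr_wpDr.
  rewrite -subr_ge0.
  have -> : - (x + 1)^-1 + x^-1 - ((x + 1) ^+ 2)^-1 = (x * (x + 1) ^+ 2)^-1.
    by field; rewrite !lt0r_neq0.
  by rewrite invr_ge0 mulr_ge0 ?exprn_ge0 // ltW.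
apply: le_trans (ler_sum_nat step) _; rewrite telescope_sumr; last exact: ltnW.
by rewrite /f /= opprK gerDr oppr_le0 invr_ge0.
Qed.

(** Each dyadic block (2^q, 2^(q + 1)] contributes at least 1/2. *)
Lemma sum_inv_dyadic p k :
  k%:R / 2 <= \sum_((2 ^ p).+1 <= j < (2 ^ (p + k)).+1) j%:R^-1 :> R.
Proof.
elim: k => [|k IH]; first by rewrite mul0r sumr_ge0.
have e0 : (0 < 2 ^ (p + k))%N by rewrite expn_gt0.
have E : (2 ^ (p + k.+1) = 2 ^ (p + k) + 2 ^ (p + k))%N by rewrite addnS expnS; lia.
rewrite (big_cat_nat (n := (2 ^ (p + k)).+1)) /=; last 2 first.
- by rewrite ltnS leq_exp2l // leq_addr.
- by rewrite ltnS E leq_addr.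
rewrite -natr1 mulrDl; apply: lerD => //.
rewrite E; set N := (2 ^ (p + k))%N in e0 *.
apply: (@le_trans _ _ (\sum_(N.+1 <= j < (N + N).+1) (N + N)%:R^-1)).
  rewrite big_const_nat iter_addr_0 subSS addKn -mulr_natr natrD.
  have : 0 < N%:R :> R by rewrite ltr0n.
  by move=> N0; rewrite le_eqVlt; apply/orP; left; apply/eqP; field; lra.
apply: ler_sum_nat => j /andP[Nj jN].
rewrite lef_pV2 ?posrE ?ltr0n ?ler_nat //; lia.
Qed.

End Sums.

Section Walks.
Variables (R : realType) (c : R) (n : nat).
Hypothesis c_gt0 : 0 < c.
Implicit Types v w x : 'I_n.

(** The first-moment bound for the number of trails of length t from v to w in
    the random graph; walks that repeat edges are counted as well, which only
    weakens the bound. *)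
Fixpoint walk_weight (t : nat) v w : R :=
  if t is t'.+1 then
    \sum_(x | x != v) (1 + c) / (maxn v x)%:R * walk_weight t' x w
  else (v == w)%:R.

Lemma walk_weightS t v w : walk_weight t.+1 v w =
  \sum_(x | x != v) (1 + c) / (maxn v x)%:R * walk_weight t x w.
Proof. by []. Qed.

Lemma walk_weight_ge0 t v w : 0 <= walk_weight t v w.
Proof.
elim: t v => [|t IH] v /=; first exact: ler0n.
by apply: sumr_ge0 => x _; rewrite !mulr_ge0 ?invr_ge0 // addr_ge0 // ltW.
Qed.

Lemma edge_weight_le v x : x != v ->
  (1 + c) / (maxn v x)%:R <= 2 * (1 + c) / (maxn v x).+1%:R.
Proof.
move=> xv; have m0 : (0 < maxn v x)%N.
  by rewrite lt0n; apply: contraNneq xv => E; apply/eqP/val_inj => /=; lia.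
rewrite [2 * _]mulrC -mulrA ler_pM2l ?addr_gt0 //.
rewrite -subr_ge0.
have m1 : 1 <= (maxn v x)%:R :> R by rewrite ler1n.
rewrite -(natr1 (maxn v x)); move: (maxn v x)%:R m1 => m m1.
have -> : 2 / (m + 1) - m^-1 = (m - 1) / (m * (m + 1)).
  by field; rewrite !lt0r_neq0 //; lra.
by rewrite divr_ge0 ?mulr_ge0 //; lra.
Qed.

(** By induction on the length with [kernel_rsqrt]: every step costs a factor
    4 * 2 (1 + c), the 2 coming from 1 / m <= 2 / (m + 1). *)
Lemma walk_weight_le t v w :
  walk_weight t.+1 v w <= (8 * (1 + c)) ^+ t.+1 * (rsqrt R v * rsqrt R w).
Proof.
have g0 (x : 'I_n) : 0 < rsqrt R x := rsqrt_gt0 R x.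
elim: t v => [|t IH] v.
  rewrite /= expr1.
  have rhs0 : 0 <= 8 * (1 + c) * (rsqrt R v * rsqrt R w).
    by rewrite !mulr_ge0 ?ltW // addr_gt0.
  have [->|wv] := eqVneq w v.
    rewrite big1 => [|x /negPf ->]; last by rewrite mulr0.
    by rewrite !mulr_ge0 ?ltW // addr_gt0.
  rewrite (bigD1 w) //= eqxx mulr1 big1 => [|x /andP[_ /negPf ->]]; last first.
    by rewrite mulr0.
  rewrite addr0 (le_trans (edge_weight_le wv)) //.
  apply: (@le_trans _ _ (2 * (1 + c) * (rsqrt R v * rsqrt R w))); last first.
    by rewrite ler_pM2r ?mulr_gt0 // ler_pM2r ?addr_gt0 // ler_nat.
  rewrite ler_pM2l ?mulr_gt0 ?addr_gt0 //.
  rewrite -[leLHS]rsqrt_sqr expr2.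
  have mono i j : (i <= j)%N -> rsqrt R j <= rsqrt R i.
    by move=> ij; rewrite lef_pV2 ?posrE ?sqrtr_gt0 // ler_wsqrtr // ler_nat.
  by apply: ler_pM; rewrite ?[0 <= _]ltW ?rsqrt_gt0 ?mono ?leq_maxl ?leq_maxr.
rewrite walk_weightS.
set C := 8 * (1 + c) in IH *.
have C0 : 0 < C by rewrite mulr_gt0 // addr_gt0.
apply: (@le_trans _ _ (\sum_(x < n) 2 * (1 + c) * C ^+ t.+1 * rsqrt R w *
    (rsqrt R x / (maxn v x).+1%:R))).
  rewrite [leRHS](bigID (fun x => x != v)) /= -[leLHS]addr0; apply: lerD.
    apply: ler_sum => x xv.
    have -> : 2 * (1 + c) * C ^+ t.+1 * rsqrt R w * (rsqrt R x / (maxn v x).+1%:R)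
      = 2 * (1 + c) / (maxn v x).+1%:R * (C ^+ t.+1 * (rsqrt R x * rsqrt R w)).
      by ring.
    apply: ler_pM (walk_weight_ge0 t.+1 x w) (edge_weight_le xv) (IH x).
    by rewrite divr_ge0 // addr_ge0 // ltW.
  by apply: sumr_ge0 => x _; rewrite !mulr_ge0 ?exprn_ge0 ?invr_ge0 ?[0 <= _]ltW ?addr_gt0.
rewrite -mulr_sumr -(big_mkord predT (fun x : nat => rsqrt R x / (maxn v x).+1%:R)).
have -> : C ^+ t.+2 * (rsqrt R v * rsqrt R w) =
    2 * (1 + c) * C ^+ t.+1 * rsqrt R w * (4 * rsqrt R v).
  by rewrite exprS {1}/C; ring.
by rewrite ler_pM2l ?kernel_rsqrt // !mulr_gt0 ?exprn_gt0 ?addr_gt0.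
Qed.

(** If the third walk is empty then w = v and the first two walks give
    g(v)^4 <= g(v)^3; otherwise the three walks give g(v)^3 g(w)^3.  The sum of
    g^3 is at most 3. *)
Lemma sum_theta_weight t1 t2 t3 :
  \sum_(v < n) \sum_(w < n)
    (walk_weight t1.+1 v w * (walk_weight t2.+1 v w * walk_weight t3 w v)) <=
  9 * (8 * (1 + c)) ^+ (t1.+1 + t2.+1 + t3).
Proof.
set C := 8 * (1 + c).
have C0 : 0 < C by rewrite mulr_gt0 // addr_gt0.
have g0 (x : 'I_n) : 0 < rsqrt R x := rsqrt_gt0 R x.
have g3 : \sum_(v < n) rsqrt R v ^+ 3 <= 3.
  by rewrite -(big_mkord predT (fun x : nat => rsqrt R x ^+ 3)) sum_rsqrt3.
have g3_0 : 0 <= \sum_(v < n) rsqrt R v ^+ 3.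
  by apply: sumr_ge0 => v _; rewrite exprn_ge0 // ltW.
have two v w : walk_weight t1.+1 v w * walk_weight t2.+1 v w <=
    C ^+ (t1.+1 + t2.+1) * (rsqrt R v * rsqrt R w) ^+ 2.
  apply: le_trans (ler_pM _ _ (walk_weight_le t1 v w) (walk_weight_le t2 v w)) _;
    rewrite ?walk_weight_ge0 //.
  by rewrite -/C exprD expr2 mulrACA.
case: t3 => [|t3].
  rewrite addn0.
  apply: (@le_trans _ _ (\sum_(v < n) C ^+ (t1.+1 + t2.+1) * rsqrt R v ^+ 3)).
    apply: ler_sum => v _.
    rewrite (bigD1 v) //= -!walk_weightS big1 => [|w /negPf wv]; last first.
      by rewrite wv !mulr0.
    rewrite addr0 eqxx mulr1 (le_trans (two v v)) // ler_pM2l ?exprn_gt0 //.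
    rewrite -expr2 -exprM; apply: ler_wiXn2l => //; [exact: ltW|exact: rsqrt_le1].
  rewrite -mulr_sumr mulrC ler_pM2r ?exprn_gt0 // (le_trans g3) // ler_nat //.
apply: (@le_trans _ _ (\sum_(v < n) \sum_(w < n)
    C ^+ (t1.+1 + t2.+1 + t3.+1) * (rsqrt R v ^+ 3 * rsqrt R w ^+ 3))).
  apply: ler_sum => v _; apply: ler_sum => w _; rewrite mulrA.
  apply: le_trans (ler_pM _ _ (two v w) (walk_weight_le t3 w v)) _;
    rewrite ?mulr_ge0 ?walk_weight_ge0 //.
  by rewrite -/C [in leRHS]exprD le_eqVlt; apply/orP; left; apply/eqP; ring.
have -> : \sum_(v < n) \sum_(w < n)
    C ^+ (t1.+1 + t2.+1 + t3.+1) * (rsqrt R v ^+ 3 * rsqrt R w ^+ 3) =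
    C ^+ (t1.+1 + t2.+1 + t3.+1) *
    ((\sum_(v < n) rsqrt R v ^+ 3) * (\sum_(v < n) rsqrt R v ^+ 3)).
  rewrite mulr_suml mulr_sumr; apply: eq_bigr => v _.
  by rewrite mulr_sumr mulr_sumr.
rewrite mulrC ler_pM2r ?exprn_gt0 //.
have -> : 9 = 3 * 3 :> R by ring.
exact: ler_pM.
Qed.

End Walks.

(** * Short thetas and the label-free rule *)

Section Trails.
Variable n : nat.
Implicit Types (H F : edge_set n) (v w : 'I_n).

(** Trails in continuation-passing style: F is the set of edges that are already
    used, and Phi is what remains to be built once w is reached, given all the
    edges used so far.  Chaining several trails then makes them edge-disjoint,
    and a first-moment bound for a chain follows by induction on one trail. *)
Fixpoint trail H (t : nat) v w (Phi : edge_set n -> bool) F : bool :=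
  if t is t'.+1 then
    [exists x, [&& x != v, [set v; x]%SET \in H, [set v; x]%SET \notin F
                 & trail H t' x w Phi ([set v; x]%SET |: F)%SET]]
  else (v == w) && Phi F.

(** Two nonempty trails from v to w and one, possibly empty, back from w to v,
    pairwise edge-disjoint. *)
Definition theta (s : nat) H v : bool :=
  [exists w, exists t1 : 'I_s, exists t2 : 'I_s, exists t3 : 'I_s,
    trail H t1.+1 v w (trail H t2.+1 v w (trail H t3 w v predT)) finset.set0].

(** Cutting at K makes the size bound deterministic; the cut is rare by Markov's
    inequality. *)
Definition theta_rule (s K : nat) H : {set 'I_n} :=
  let A := [set v | theta s H v]%SET in
  if (#|A| <= K)%N then A else finset.set0.

Lemma mem_relabel (pi : {perm 'I_n}) H (e : {set 'I_n}) :
  (imset pi (mem e) \in relabel pi H) = (e \in H).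
Proof.
apply: (mem_imset (f := fun e : {set 'I_n} => imset pi (mem e))).
exact: imset_inj (@perm_inj _ pi).
Qed.

Lemma relabelU1 (pi : {perm 'I_n}) (e : {set 'I_n}) F :
  relabel pi (e |: F)%SET = (imset pi (mem e) |: relabel pi F)%SET.
Proof. by rewrite /relabel imsetU1. Qed.

Lemma trail_relabel (pi : {perm 'I_n}) H (Phi Phi' : edge_set n -> bool) :
  (forall F, Phi' (relabel pi F) = Phi F) ->
  forall t v w F,
  trail (relabel pi H) t (pi v) (pi w) Phi' (relabel pi F) = trail H t v w Phi F.
Proof.
move=> PhiE; elim=> [|t IH] v w F /=; first by rewrite (inj_eq perm_inj) PhiE.
have pairE x : imset pi (mem [set v; x]%SET) = [set pi v; pi x]%SET.
  by rewrite imsetU1 imset_set1.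
have stepE x : [&& pi x != pi v, [set pi v; pi x]%SET \in relabel pi H,
    [set pi v; pi x]%SET \notin relabel pi F &
    trail (relabel pi H) t (pi x) (pi w) Phi'
      ([set pi v; pi x]%SET |: relabel pi F)%SET] =
  [&& x != v, [set v; x]%SET \in H, [set v; x]%SET \notin F
                 & trail H t x w Phi ([set v; x]%SET |: F)%SET].
  by rewrite -pairE !mem_relabel -relabelU1 IH (inj_eq perm_inj).
apply/existsP/existsP=> -[x Hx].
  by exists (pi^-1 x)%g; rewrite -stepE permKV.
by exists (pi x); rewrite stepE.
Qed.

Lemma theta_relabel (pi : {perm 'I_n}) s H v :
  theta s (relabel pi H) (pi v) = theta s H v.
Proof.
have thetaE w (t1 t2 t3 : 'I_s) :
    trail (relabel pi H) t1.+1 (pi v) (pi w) (trail (relabel pi H) t2.+1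
      (pi v) (pi w) (trail (relabel pi H) t3 (pi w) (pi v) predT)) finset.set0 =
    trail H t1.+1 v w (trail H t2.+1 v w (trail H t3 w v predT)) finset.set0.
  rewrite -[X in trail _ _ _ _ _ X = _](imset0 (fun e : {set 'I_n} => imset pi (mem e))).
  by do 3!(apply: trail_relabel => ?).
apply/existsP/existsP=> -[w /existsP[t1 /existsP[t2 /existsP[t3 Ht]]]].
  exists (pi^-1 w)%g; apply/existsP; exists t1; apply/existsP; exists t2.
  by apply/existsP; exists t3; rewrite -thetaE permKV.
exists (pi w); apply/existsP; exists t1; apply/existsP; exists t2.
by apply/existsP; exists t3; rewrite thetaE.
Qed.

Lemma label_free_theta_rule s K : label_free (theta_rule s K).
Proof.
move=> H pi _.
have truncE (A A' : {set 'I_n}) : A' = imset pi (mem A) ->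
    (if (#|A'| <= K)%N then A' else finset.set0) =
    imset pi (mem (if (#|A| <= K)%N then A else finset.set0)).
  move=> ->; rewrite card_imset; last exact: perm_inj.
  by case: ifP => // _; rewrite imset0.
apply: truncE; apply/setP=> v; rewrite -[v](permKV pi) mem_imset ?inE.
  exact: theta_relabel.
exact: perm_inj.
Qed.

Lemma card_theta_rule s K H : (#|theta_rule s K H| <= K)%N.
Proof. by rewrite /theta_rule; case: ifP => //; rewrite cards0. Qed.

End Trails.

(** * A theta at the root of a recursive tree *)

Section RecursiveTree.
Variable n : nat.
Variable par : 'I_n.+1 -> 'I_n.+1.
Hypothesis par_lt : forall i : 'I_n.+1, (0 < i)%N -> (par i < i)%N.
Implicit Types (u v w : 'I_n.+1) (F H : edge_set n.+1).

(** deep t u says that u has at least t ancestors before the root is passed. *)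
Fixpoint deep (t : nat) u : bool :=
  if t is t'.+1 then (0 < u)%N && deep t' (par u) else true.

(** The tree edges of the path of length t upwards from u are the edges from these
    vertices to their parents. *)
Fixpoint lineage (t : nat) u : {set 'I_n.+1} :=
  if t is t'.+1 then u |: lineage t' (par u) else finset.set0.

Definition parent_edge u : {set 'I_n.+1} := [set u; par u]%SET.

Lemma deepD a b u : deep (a + b) u = deep a u && deep b (iter a par u).
Proof.
elim: a u => [//|a IH] u; rewrite addSn [deep _.+1 _]/= IH /= andbA.
by rewrite -iterSr.
Qed.

Lemma deep_leq a b u : (a <= b)%N -> deep b u -> deep a u.
Proof. by move=> /subnKC <-; rewrite deepD => /andP[]. Qed.

Lemma iter_par_leq a u : deep a u -> (iter a par u <= u)%N.
Proof.
elim: a u => [//|a IH] u /= /andP[u_gt0 /IH]; rewrite -iterSr /= => H.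
exact: leq_trans H (ltnW (par_lt u_gt0)).
Qed.

Lemma lineage_leq a u x : deep a u -> x \in lineage a u -> (x <= u)%N.
Proof.
elim: a u => [|a IH] u /=; first by rewrite inE.
case/andP=> u_gt0 Hd; rewrite in_setU1 => /predU1P[-> //|/(IH _ Hd) Hx].
exact: leq_trans Hx (ltnW (par_lt u_gt0)).
Qed.

Lemma lineage_gt0 a u x : deep a u -> x \in lineage a u -> (0 < x)%N.
Proof.
elim: a u => [|a IH] u /=; first by rewrite inE.
by case/andP=> u_gt0 Hd; rewrite in_setU1 => /predU1P[-> //|/(IH _ Hd)].
Qed.

Lemma reach_root u : exists2 t, deep t u & iter t par u = ord0.
Proof.
have [m] := ubnP (nat_of_ord u); elim: m u => // m IH u Hu.
have [u0|u_gt0] := posnP u; first by exists 0%N => //; apply: val_inj.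
have [|t Ht1 Ht2] := IH (par u).
  exact: leq_trans (par_lt u_gt0) Hu.
by exists t.+1; rewrite /= ?u_gt0 // -iterS iterSr.
Qed.

(** Follow the two paths upwards, always moving the token at the larger vertex.
    The larger vertex exceeds everything still to be visited, so the vertices left
    behind are distinct from one another and larger than the meeting point. *)
Lemma common_ancestor u v : exists a b,
  [/\ deep a u /\ deep b v, iter a par u = iter b par v,
      forall x, x \in lineage a u -> (iter a par u < x)%N,
      forall x, x \in lineage b v -> (iter a par u < x)%N &
      [disjoint lineage a u & lineage b v]].
Proof.
have [m] := ubnP (u + v)%N; elim: m u v => // m IH u v.
wlog vu : u v / (v <= u)%N => [H|].
  case/orP: (leq_total v u) => [|uv] Hm; first exact: H.
  rewrite addnC in Hm; have [a [b [[? ?] E ? ? ?]]] := H v u uv Hm.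
  by exists b, a; rewrite -E disjoint_sym.
move: vu; rewrite leq_eqVlt => /predU1P[/val_inj -> _|vu Hm].
  exists 0%N, 0%N; split=> //= [x|x|]; rewrite ?inE //.
  by rewrite finset.disjoints_subset finset.sub0set.
have u_gt0 : (0 < u)%N by exact: leq_ltn_trans vu.
have pu := par_lt u_gt0.
have [|a [b [[Ha Hb] E La Lb D]]] := IH (par u) v; first by lia.
have wv : (iter b par v <= v)%N by exact: iter_par_leq.
exists a.+1, b; rewrite iterSr /= u_gt0; split=> //.
  move=> x; rewrite in_setU1 => /predU1P[->|]; last exact: La.
  by rewrite E; exact: leq_ltn_trans vu.
rewrite finset.disjoints_subset finset.subUset finset.sub1set -finset.disjoints_subset D andbT inE.
by apply/negP => /(lineage_leq Hb); rewrite leqNgt vu.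
Qed.

Lemma parent_edge_inj u v : (0 < u)%N -> (0 < v)%N ->
  parent_edge u = parent_edge v -> u = v.
Proof.
move=> u_gt0 v_gt0 E; apply/eqP/negPn/negP => uv.
have : u \in parent_edge v by rewrite -E !inE eqxx.
rewrite !inE (negPf uv) => /= /eqP uE.
have : v \in parent_edge u by rewrite E !inE eqxx.
rewrite !inE eq_sym (negPf uv) => /= /eqP vE.
by have := par_lt u_gt0; have := par_lt v_gt0; rewrite -uE -vE; lia.
Qed.

(** An edge from the root to u is not a tree edge as soon as the parent of u is
    not the root. *)
Lemma parent_edge_neq_root u v : (0 < u)%N -> (0 < par u)%N -> (0 < v)%N ->
  parent_edge v != [set ord0; u]%SET.
Proof.
move=> u_gt0 pu v_gt0; apply/eqP => E.
have : ord0 \in parent_edge v by rewrite E !inE eqxx.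
rewrite !inE => /orP[] /eqP E0; first by rewrite -E0 in v_gt0.
have : u \in parent_edge v by rewrite E !inE eqxx orbT.
rewrite !inE => /orP[] /eqP uE; first by rewrite uE -E0 in pu.
by rewrite uE -E0 in u_gt0.
Qed.

(** The upward path of length a from u is a trail; its continuation may rely on
    any property of the used edges that follows from their being old ones or tree
    edges of the lineage. *)
Lemma trail_descend H (Phi : edge_set n.+1 -> bool) a u F :
  (forall i : 'I_n.+1, (0 < i)%N -> parent_edge i \in H) ->
  deep a u ->
  (forall x, x \in lineage a u -> parent_edge x \notin F) ->
  (forall F', (forall e, e \in F' ->
      e \in F \/ exists2 x, x \in lineage a u & e = parent_edge x) -> Phi F') ->
  trail H a u (iter a par u) Phi F.
Proof.
move=> HH; elim: a u F => [|a IH] u F.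
  by move=> _ _ HPhi /=; rewrite eqxx HPhi // => e; left.
move=> /[dup] Hd /= /andP[u_gt0 Hd'] Hav HPhi.
apply/existsP; exists (par u); rewrite -iterS iterSr.
have pu := par_lt u_gt0.
apply/and4P; split.
- by rewrite neq_ltn pu.
- exact: HH.
- by apply: Hav; rewrite !inE eqxx.
apply: IH => //.
  move=> x Hx; rewrite in_setU1 negb_or Hav ?inE ?Hx ?orbT // andbT.
  apply/eqP => /parent_edge_inj E.
  have xu : x = u by apply: E => //; exact: lineage_gt0 Hd' Hx.
  by have := lineage_leq Hd' Hx; rewrite xu leqNgt pu.
move=> F' HF'; apply: HPhi => e /HF'[|[x Hx ->]].
  rewrite in_setU1 => /predU1P[->|]; last by left.
  by right; exists u => //; rewrite !inE eqxx.
by right; exists x => //; rewrite !inE Hx orbT.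
Qed.

(** Both trails from the root start with one of the two extra edges and follow the
    tree up to the common ancestor w; the third one is the tree path from w to the
    root.  The lineages used are disjoint by [common_ancestor]: those of u and v
    stay above w, that of w does not.  If w is the root the third trail is empty
    and the result is a figure eight. *)
Lemma theta_root H s u v :
  (forall i : 'I_n.+1, (0 < i)%N -> parent_edge i \in H) ->
  [set ord0; u]%SET \in H -> [set ord0; v]%SET \in H ->
  (0 < par u)%N -> (0 < par v)%N -> (0 < u)%N -> (0 < v)%N -> u != v ->
  ~~ deep s u -> ~~ deep s v -> theta s H ord0.
Proof.
move=> HH Hu Hv pu pv u_gt0 v_gt0 uv Du Dv.
have [a [b [[Ha Hb] E La Lb D]]] := common_ancestor u v.
set w := iter a par u in E La Lb.
have [t Ht tE] := reach_root w.
have shallow x c : deep c x -> ~~ deep s x -> (c < s)%N.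
  by move=> Hc; apply: contraR; rewrite -leqNgt => /deep_leq; apply.
have as_ : (a < s)%N by exact: shallow Ha Du.
have bs : (b < s)%N by exact: shallow Hb Dv.
have ts : (t < s)%N.
  apply: leq_ltn_trans (leq_addl a t) _; apply: shallow Du.
  by rewrite deepD Ha.
have neq0 (x : 'I_n.+1) : (0 < x)%N -> x != ord0 :> 'I_n.+1.
  by move=> x0; rewrite -(inj_eq val_inj) /= -lt0n.
apply/existsP; exists w; apply/existsP; exists (Ordinal as_).
apply/existsP; exists (Ordinal bs); apply/existsP; exists (Ordinal ts).
rewrite [trail]lock /= -lock.
apply/existsP; exists u; rewrite neq0 // Hu inE /= finset.setU0.
apply: trail_descend => // [x Hx|F1 HF1].
  by rewrite inE parent_edge_neq_root // (lineage_gt0 Ha).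
apply/existsP; exists v; rewrite neq0 // Hv /=.
apply/andP; split.
  apply/negP => /HF1[].
    rewrite inE => /eqP/setP/(_ v); rewrite !inE eqxx orbT.
    by rewrite [v == u]eq_sym (negPf uv) orbF (negPf (neq0 _ v_gt0)).
  move=> [x Hx /esym/eqP]; apply/negP/parent_edge_neq_root => //.
  exact: lineage_gt0 Hx.
rewrite E; apply: trail_descend => // [x Hx|F2 HF2].
  have x_gt0 := lineage_gt0 Hb Hx.
  rewrite in_setU1 negb_or parent_edge_neq_root //=.
  apply/negP => /HF1[]; first by rewrite inE; apply/negP/parent_edge_neq_root.
  move=> [y Hy /parent_edge_inj E'].
  have yx : x = y by apply: E' => //; exact: lineage_gt0 Hy.
  by move/finset.disjoint_setI0: D => /setP/(_ x); rewrite !inE Hx yx Hy.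
rewrite -E -tE; apply: trail_descend => // x Hx.
have x_gt0 := lineage_gt0 Ht Hx; have xw := lineage_leq Ht Hx.
apply/negP => /HF2[].
  rewrite in_setU1 => /predU1P[|/HF1[]].
  - by apply/eqP/parent_edge_neq_root.
  - by rewrite inE; apply/negP/parent_edge_neq_root.
  move=> [y Hy /parent_edge_inj E'].
  have yx : x = y by apply: E' => //; exact: lineage_gt0 Hy.
  by have := La _ Hy; rewrite -yx ltnNge xw.
move=> [y Hy /parent_edge_inj E'].
have yx : x = y by apply: E' => //; exact: lineage_gt0 Hy.
by have := Lb _ Hy; rewrite -yx ltnNge xw.
Qed.

End RecursiveTree.

(** * Probability mass functions on a finite set *)

Section FiniteProbability.
Variables (R : realType) (O : finType) (m : O -> R).

Definition pr (A : pred O) : R := \sum_(z | A z) m z.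

Hypothesis m_ge0 : forall z, 0 <= m z.

Lemma prE (A : pred O) : pr A = \sum_z m z * (A z)%:R.
Proof.
rewrite /pr big_mkcond; apply: eq_bigr => z _.
by case: (A z); rewrite ?mulr1 ?mulr0.
Qed.

(** Union bound; the inclusion of events is only required where the mass is not 0. *)
Lemma pr_le_sum (I : finType) (P : pred I) (A : pred O) (B : I -> pred O) :
  (forall z, m z != 0 -> A z -> exists2 i, P i & B i z) ->
  pr A <= \sum_(i | P i) pr (B i).
Proof.
move=> AB; rewrite prE.
under [leRHS]eq_bigr do rewrite prE.
rewrite exchange_big /=; apply: ler_sum => z _; rewrite -mulr_sumr.
have [->|mz] := eqVneq (m z) 0; first by rewrite !mul0r.
apply: ler_wpM2l => //; case: (boolP (A z)) => [/(AB _ mz)[i Pi Bi]|_].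
  by rewrite (bigD1 i) //= Bi lerDl sumr_ge0 // => j _; exact: ler0n.
by apply: sumr_ge0 => j _; exact: ler0n.
Qed.

Lemma le_pr (A B : pred O) : (forall z, m z != 0 -> A z -> B z) -> pr A <= pr B.
Proof.
move=> AB; have := @pr_le_sum unit predT A (fun=> B).
rewrite (big_pred1 tt) => [|[]] //; apply => z mz Az.
by exists tt => //; exact: AB.
Qed.

Lemma prU (A B1 B2 : pred O) : (forall z, m z != 0 -> A z -> B1 z || B2 z) ->
  pr A <= pr B1 + pr B2.
Proof.
move=> AB; have := @pr_le_sum bool predT A (fun b => if b then B1 else B2).
rewrite big_bool /=; apply => z mz /(AB _ mz)/orP[Bz|Bz].
- by exists true.
- by exists false.
Qed.

Lemma prC (A : pred O) : \sum_z m z = 1 -> pr (predC A) = 1 - pr A.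
Proof.
by rewrite (bigID A) /= => /(canRL (addKr _)); rewrite /pr /= addrC => ->.
Qed.

(** Markov's inequality for the number of v such that Q v holds. *)
Lemma pr_card_gt (V : finType) (Q : V -> pred O) (K : nat) :
  K.+1%:R * pr (fun z => (K < #|[set v | Q v z]%SET|)%N) <= \sum_v pr (Q v).
Proof.
rewrite prE; under [leRHS]eq_bigr do rewrite prE.
rewrite exchange_big /= mulr_sumr; apply: ler_sum => z _; rewrite -mulr_sumr mulrCA.
apply: ler_wpM2l => //.
have -> : \sum_v (Q v z)%:R = #|[set v | Q v z]%SET|%:R :> R.
  rewrite -sum1_card natr_sum [RHS]big_mkcond /=; apply: eq_bigr => v _.
  by rewrite inE; case: (Q v z).
by case: ltnP => H; rewrite ?mulr1 ?mulr0 ?ler0n // ler_nat.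
Qed.

End FiniteProbability.

(** * Expected number of thetas in the Cooper-Frieze graph *)

Section CooperFrieze.
Variables (R : realType) (c : R) (n : nat).
Hypothesis c_gt0 : 0 < c.
Notation V := 'I_n.+1.

Definition outcome : finType := ({ffun V -> V} * edge_set n.+1)%type.

Implicit Types (J : {set V}) (x : V -> V) (F : edge_set n.+1) (z : outcome).

Definition tree_edges (f : V -> V) : edge_set n.+1 :=
  [set [set i; f i]%SET | i in [set i : V | (0 < i)%N]%SET]%SET.

Lemma mem_tree_edges (f : V -> V) (i j : V) :
  (forall k : V, (0 < k)%N -> (f k < k)%N) -> (j < i)%N ->
  ([set i; j]%SET \in tree_edges f) = (f i == j).
Proof.
move=> f_lt ij; apply/imsetP/eqP => [[k]|<-]; last first.
  by exists i; rewrite ?inE // (leq_ltn_trans _ ij).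
rewrite inE => /f_lt fk E.
have : i \in [set k; f k]%SET by rewrite -E !inE eqxx.
have : j \in [set k; f k]%SET by rewrite -E !inE eqxx orbT.
rewrite !inE => /orP[]/eqP jE /orP[]/eqP iE.
- by rewrite jE iE ltnn in ij.
- by move: ij; rewrite jE iE ltnNge (ltnW fk).
- by rewrite iE -jE.
- by rewrite jE iE ltnn in ij.
Qed.

Definition union_graph (z : outcome) : edge_set n.+1 :=
  (tree_edges z.1 :|: z.2)%SET.

Definition larger_end (e : {set V}) : nat := \max_(i in e) i.

Lemma larger_end_pair (v w : V) : larger_end [set v; w]%SET = maxn v w.
Proof.
rewrite /larger_end; have [->|vw] := eqVneq v w.
  by rewrite finset.setUid big_set1 maxnn.
by rewrite big_setU1 ?inE // big_set1.
Qed.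

(** The events whose probability is known exactly: parents are prescribed on J,
    and the edges of F are required to be extra edges. *)
Definition prescribed (J : {set V}) (x : V -> V) (F : edge_set n.+1) (z : outcome) :=
  [forall i in J, z.1 i == x i] && (F \subset z.2).

Definition admissible (J : {set V}) (x : V -> V) (F : edge_set n.+1) :=
  (forall i, i \in J -> (x i < i)%N) /\ (forall e, e \in F -> #|e| = 2%N).

Definition extra_prob (e : {set V}) : R := Num.min (c / (larger_end e)%:R) 1.

(** The Cooper-Frieze model in terms of the mass function of the pair (parents,
    extra edges). *)
Record cooper_frieze_law (m : outcome -> R) : Prop := CooperFriezeLaw {
  law_ge0 : forall z, 0 <= m z;
  law_sum1 : \sum_z m z = 1;
  law_tree : forall z, m z != 0 -> forall i : V, (0 < i)%N -> (z.1 i < i)%N;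
  law_prescribed : forall J x F, admissible J x F ->
    pr m (prescribed J x F) =
      (\prod_(i in J) (i : nat)%:R^-1) * \prod_(e in F) extra_prob e
}.

Variable m : outcome -> R.
Hypothesis lawm : cooper_frieze_law m.
Notation Pr := (pr m).
Let m_ge0 := law_ge0 lawm.

(** The probability of [prescribed J x F] with min(c / m, 1) relaxed to c / m. *)
Definition prescribed_weight (J : {set V}) (F : edge_set n.+1) : R :=
  (\prod_(i in J) (i : nat)%:R^-1) * \prod_(e in F) (c / (larger_end e)%:R).

Definition prescribed_edges (J : {set V}) (x : V -> V) (F : edge_set n.+1) :
  edge_set n.+1 := ([set [set i; x i]%SET | i in J]%SET :|: F)%SET.

Lemma prescribed_weight_ge0 J F : 0 <= prescribed_weight J F.
Proof.
by rewrite mulr_ge0 ?prodr_ge0 // => i _; rewrite ?divr_ge0 ?invr_ge0 // ltW.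
Qed.

Lemma pr_prescribed_le J x F : admissible J x F ->
  Pr (prescribed J x F) <= prescribed_weight J F.
Proof.
move=> adm; rewrite (law_prescribed lawm adm).
apply: ler_wpM2l; first by rewrite prodr_ge0 // => i _; rewrite invr_ge0.
apply: ler_prod => e _; rewrite ge_min lexx /= andbT le_min ler01 andbT.
by rewrite divr_ge0 // ltW.
Qed.

Definition prescribe (x : V -> V) (i j : V) : V -> V :=
  fun k => if k == i then j else x k.

Lemma prescribedU1 J x F i j z : i \notin J -> z.1 i = j ->
  prescribed J x F z -> prescribed (i |: J)%SET (prescribe x i j) F z.
Proof.
move=> iJ zi /andP[/forall_inP HJ HF]; rewrite /prescribed HF andbT.
apply/forall_inP => k; rewrite in_setU1 /prescribe.
have [-> _|ki /= kJ] := eqVneq k i; first by rewrite zi.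
exact: HJ.
Qed.

Lemma admissibleU1 J x F (i j : V) : (j < i)%N ->
  admissible J x F -> admissible (i |: J)%SET (prescribe x i j) F.
Proof.
move=> ji [HJ HF]; split=> // k; rewrite in_setU1 /prescribe.
by have [-> _|ki /= /HJ] := eqVneq k i.
Qed.

Lemma prescribed_edgesU1 J x F (i j : V) : i \notin J ->
  prescribed_edges (i |: J)%SET (prescribe x i j) F =
  ([set i; j]%SET |: prescribed_edges J x F)%SET.
Proof.
move=> iJ; rewrite /prescribed_edges imsetU1 -finset.setUA {1}/prescribe eqxx.
congr (_ |: (_ :|: _))%SET; apply: eq_in_imset => k kJ; rewrite /prescribe.
by case: eqP => // ki; rewrite -ki kJ in iJ.
Qed.

Lemma prescribed_weightU1l J F (i : V) : i \notin J ->
  prescribed_weight (i |: J)%SET F = (i : nat)%:R^-1 * prescribed_weight J F.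
Proof. by move=> iJ; rewrite /prescribed_weight big_setU1 //= mulrA. Qed.

Lemma prescribed_weightU1r J F e : e \notin F ->
  prescribed_weight J (e |: F)%SET = c / (larger_end e)%:R * prescribed_weight J F.
Proof. by move=> iJ; rewrite /prescribed_weight big_setU1 //= mulrCA. Qed.

(** One step of a trail along a new tree edge {i, j} with j < i prescribes the
    parent j of i.  If the parent of i was prescribed already it is j, so the edge
    is not new, and the event is void. *)
Lemma pr_trail_step_tree J x F (v y : V) (Psi : outcome -> edge_set n.+1 -> bool)
    (b : R) : 0 <= b -> y != v -> admissible J x F ->
  (forall J' x' F', admissible J' x' F' ->
    Pr (fun z => prescribed J' x' F' z && Psi z (prescribed_edges J' x' F'))
      <= prescribed_weight J' F' * b) ->
  Pr (fun z => [&& prescribed J x F z, [set v; y]%SET \in tree_edges z.1,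
        [set v; y]%SET \notin prescribed_edges J x F &
        Psi z ([set v; y]%SET |: prescribed_edges J x F)%SET]) <=
  (maxn v y)%:R^-1 * (prescribed_weight J F * b).
Proof.
move=> b0 yv adm HPsi.
have rhs0 : 0 <= (maxn v y)%:R^-1 * (prescribed_weight J F * b).
  by rewrite mulr_ge0 ?invr_ge0 // mulr_ge0 // prescribed_weight_ge0.
have [i [j [ij iE eE]]] : exists i j : V,
    [/\ (j < i)%N, i = maxn v y :> nat & [set v; y]%SET = [set i; j]%SET].
  case: (ltngtP v y) => [vy|yv'|/val_inj E]; last by rewrite E eqxx in yv.
    by exists y, v; split=> //; rewrite finset.setUC.
  by exists v, y.
have parE z : m z != 0 -> [set v; y]%SET \in tree_edges z.1 -> z.1 i = j.
  move=> mz; rewrite eE (mem_tree_edges _ ij) => [/eqP //|k].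
  exact: law_tree lawm _ mz _.
have [iJ|iJ] := boolP (i \in J).
  rewrite [leLHS](_ : _ = 0) //.
  rewrite /pr big1_seq // => z /andP[/and4P[/andP[/forall_inP HJ _] Ht He _] _].
  apply/eqP/negPn/negP => mz; move/negP: He; apply.
  rewrite finset.in_setU; apply/orP; left; apply/imsetP; exists i => //.
  by rewrite -(eqP (HJ _ iJ)) (parE _ mz Ht).
rewrite -iE mulrA -prescribed_weightU1l //.
apply: le_trans (HPsi _ (prescribe x i j) _ (admissibleU1 ij adm)).
apply: (le_pr m_ge0) => z mz /and4P[Hp Ht _].
by rewrite prescribed_edgesU1 // -eE => ->; rewrite (prescribedU1 iJ (parE _ mz Ht)).
Qed.

Lemma pr_trail_step_extra J x F (v y : V) (Psi : outcome -> edge_set n.+1 -> bool)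
    (b : R) : 0 <= b -> y != v -> admissible J x F ->
  (forall J' x' F', admissible J' x' F' ->
    Pr (fun z => prescribed J' x' F' z && Psi z (prescribed_edges J' x' F'))
      <= prescribed_weight J' F' * b) ->
  Pr (fun z => [&& prescribed J x F z, [set v; y]%SET \in z.2,
        [set v; y]%SET \notin prescribed_edges J x F &
        Psi z ([set v; y]%SET |: prescribed_edges J x F)%SET]) <=
  c / (maxn v y)%:R * (prescribed_weight J F * b).
Proof.
move=> b0 yv [admJ admF] HPsi.
have rhs0 : 0 <= c / (maxn v y)%:R * (prescribed_weight J F * b).
  by rewrite mulr_ge0 ?divr_ge0 ?[0 <= c]ltW // mulr_ge0 // prescribed_weight_ge0.
set e := [set v; y]%SET.
have [eF|eF] := boolP (e \in F).
  rewrite [leLHS](_ : _ = 0) //.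
  rewrite /pr big1_seq // => z /andP[/and4P[_ _ /negP[]]].
  by rewrite finset.in_setU eF orbT.
rewrite -larger_end_pair -/e mulrA -prescribed_weightU1r //.
have adm' : admissible J x (e |: F)%SET.
  split=> // e'; rewrite in_setU1 => /predU1P[->|]; last exact: admF.
  by rewrite /e cards2 eq_sym yv.
apply: le_trans (HPsi _ _ _ adm').
apply: (le_pr m_ge0) => z mz /and4P[/andP[HJ HF] He _].
rewrite /prescribed_edges finset.setUCA => ->; rewrite /prescribed HJ andbT /=.
by rewrite finset.subUset finset.sub1set He.
Qed.

(** First-moment bound for one trail on top of a continuation whose bound is b.
    Each step uses a new edge, as a tree edge (weight 1 / max) or as an extra edge
    (weight c / max); this is where the kernel (1 + c) / max comes from. *)
Lemma pr_trail_le (Phi : outcome -> edge_set n.+1 -> bool) (b : R) : 0 <= b ->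
  (forall J x F, admissible J x F ->
    Pr (fun z => prescribed J x F z && Phi z (prescribed_edges J x F))
      <= prescribed_weight J F * b) ->
  forall t v w J x F, admissible J x F ->
    Pr (fun z => prescribed J x F z &&
          trail (union_graph z) t v w (Phi z) (prescribed_edges J x F))
      <= prescribed_weight J F * (walk_weight c t v w * b).
Proof.
move=> b0 HPhi; elim=> [|t IH] v w J x F adm.
  rewrite /=; have [_|_] := eqVneq v w; first by rewrite mul1r; exact: HPhi.
  rewrite mul0r mulr0 /pr big_pred0 // => z; exact: andbF.
have ww0 := walk_weight_ge0 c_gt0.
pose Psi (y : V) z F' := trail (union_graph z) t y w (Phi z) F'.
pose B1 (y : V) : pred outcome := fun z =>
  [&& prescribed J x F z, [set v; y]%SET \in tree_edges z.1,
      [set v; y]%SET \notin prescribed_edges J x F &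
      Psi y z ([set v; y]%SET |: prescribed_edges J x F)%SET].
pose B2 (y : V) : pred outcome := fun z =>
  [&& prescribed J x F z, [set v; y]%SET \in z.2,
      [set v; y]%SET \notin prescribed_edges J x F &
      Psi y z ([set v; y]%SET |: prescribed_edges J x F)%SET].
apply: (@le_trans _ _ (\sum_(y | y != v) (Pr (B1 y) + Pr (B2 y)))).
  apply: (@le_trans _ _ (\sum_(y | y != v) Pr (fun z => B1 y z || B2 y z))).
    apply: (pr_le_sum m_ge0) => z _ /andP[Hp /existsP[y /and4P[yv Hy Hn Ht]]].
    exists y => //; move: Hy; rewrite finset.in_setU => /orP[Hy|Hy].
      by apply/orP; left; apply/and4P.
    by apply/orP; right; apply/and4P.
  by apply: ler_sum => y _; apply: (prU m_ge0).
rewrite walk_weightS mulr_suml mulr_sumr; apply: ler_sum => y yv.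
have IHy J' x' F' (adm' : admissible J' x' F') := IH y w J' x' F' adm'.
have b1 : 0 <= walk_weight c t y w * b by rewrite mulr_ge0.
have H1 := pr_trail_step_tree (Psi := Psi y) b1 yv adm IHy.
have H2 := pr_trail_step_extra (Psi := Psi y) b1 yv adm IHy.
apply: le_trans (lerD H1 H2) _.
by rewrite le_eqVlt; apply/orP; left; apply/eqP; ring.
Qed.

Lemma pr_theta_trails t1 t2 t3 (v w : V) :
  Pr (fun z => trail (union_graph z) t1 v w (trail (union_graph z) t2 v w
        (trail (union_graph z) t3 w v predT)) finset.set0) <=
  walk_weight c t1 v w * (walk_weight c t2 v w * walk_weight c t3 w v).
Proof.
have ww0 := walk_weight_ge0 c_gt0.
have H0 J x F : admissible J x F ->
    Pr (fun z => prescribed J x F z && predT (prescribed_edges J x F))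
      <= prescribed_weight J F * 1.
  by move=> /pr_prescribed_le; rewrite mulr1; apply: le_trans; apply: (le_pr m_ge0) => z _ /andP[].
have H3 := pr_trail_le (Phi := fun=> predT) ler01 H0 t3 w v.
pose Phi3 z := trail (union_graph z) t3 w v predT.
pose Phi2 z := trail (union_graph z) t2 v w (Phi3 z).
have H2 := pr_trail_le (Phi := Phi3) (mulr_ge0 (ww0 _ _ _ _) ler01) H3 t2 v w.
have H1 := pr_trail_le (Phi := Phi2)
  (mulr_ge0 (ww0 _ _ _ _) (mulr_ge0 (ww0 _ _ _ _) ler01)) H2 t1 v w.
have adm0 : admissible finset.set0 (fun i => i) finset.set0.
  by split=> ?; rewrite inE.
have := H1 _ _ _ adm0.
rewrite /prescribed_edges imset0 finset.setU0 /prescribed_weight !big_set0 !mul1r mulr1.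
apply: le_trans; apply: (le_pr m_ge0) => z _ ->; rewrite andbT.
apply/andP; split; last exact: finset.sub0set.
by apply/forall_inP => i; rewrite inE.
Qed.

(** There are s^3 <= 8^s choices of the three lengths, and each theta has at most
    3s edges. *)
Lemma sum_pr_theta_le s :
  \sum_(v : V) Pr (fun z => theta s (union_graph z) v) <=
  9 * (8 * (8 * (1 + c)) ^+ 3) ^+ s.
Proof.
pose I : finType := ('I_s * 'I_s * 'I_s)%type.
pose ww (q : I) (v w : V) := walk_weight c q.1.1.+1 v w *
  (walk_weight c q.1.2.+1 v w * walk_weight c q.2 w v).
apply: (@le_trans _ _ (\sum_(v : V) \sum_(w : V) \sum_(q : I) ww q v w)).
  apply: ler_sum => v _; rewrite pair_bigA /=.
  apply: le_trans (_ : _ <= \sum_(p : V * I) Pr (fun z =>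
     trail (union_graph z) p.2.1.1.+1 v p.1 (trail (union_graph z) p.2.1.2.+1 v p.1
        (trail (union_graph z) p.2.2 p.1 v predT)) finset.set0)) _.
    apply: (pr_le_sum m_ge0) => z _.
    move=> /existsP[w /existsP[t1 /existsP[t2 /existsP[t3 H]]]].
    by exists (w, (t1, t2, t3)).
  by apply: ler_sum => p _; exact: pr_theta_trails.
have -> : \sum_(v : V) \sum_(w : V) \sum_(q : I) ww q v w =
          \sum_(q : I) \sum_(v : V) \sum_(w : V) ww q v w.
  under eq_bigr do rewrite exchange_big /=.
  by rewrite exchange_big.
have C1 : 1 <= 8 * (1 + c) by move: c_gt0; lra.
apply: (@le_trans _ _ (\sum_(q : I) 9 * ((8 * (1 + c)) ^+ 3) ^+ s)).
  apply: ler_sum => q _; apply: le_trans (sum_theta_weight _ c_gt0 _ _ _) _.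
  rewrite ler_pM2l // -exprM ler_weXn2l //.
  by have := ltn_ord q.1.1; have := ltn_ord q.1.2; have := ltn_ord q.2; lia.
rewrite sumr_const !card_prod card_ord -[leLHS]mulr_natl mulrCA ler_pM2l //.
rewrite [in leRHS]exprMn; apply: ler_wpM2r.
  by rewrite !exprn_ge0 // (le_trans ler01).
rewrite -natrX ler_nat.
have s2 : (s <= 2 ^ s)%N by apply: ltnW; rewrite ltn_expl.
have -> : (8 ^ s = 2 ^ s * 2 ^ s * 2 ^ s)%N by rewrite -!expnMn.
by rewrite !leq_mul.
Qed.

(** The bound h(t, u) = (u + 1) / 2^t solves the recursion
    h(t + 1, u) = (1 / u) * (h(t, 0) + ... + h(t, u - 1)) of a uniform parent.  The
    parents prescribed on J, at vertices larger than u, carry the independence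
    through the induction. *)
Lemma pr_deep_le t (u : V) (J : {set V}) x :
  (forall i, i \in J -> (x i < i)%N) -> (forall i : V, i \in J -> (u < i)%N) ->
  Pr (fun z => prescribed J x finset.set0 z && deep z.1 t u) <=
  (\prod_(i in J) (i : nat)%:R^-1) * (u.+1%:R / 2 ^+ t).
Proof.
have prod0 (J' : {set V}) : 0 <= \prod_(i in J') (i : nat)%:R^-1 :> R.
  by rewrite prodr_ge0 // => i _; rewrite invr_ge0.
elim: t u J x => [|t IH] u J x admJ uJ.
  have adm : admissible J x finset.set0 by split=> // e; rewrite inE.
  rewrite expr0 divr1.
  apply: (@le_trans _ _ (Pr (prescribed J x finset.set0))).
    by apply: (le_pr m_ge0) => z _ /andP[].
  rewrite (law_prescribed lawm adm) big_set0 mulr1 ler_peMr //.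
  by rewrite ler1n.
have [u0|u_gt0] := posnP u.
  rewrite [leLHS](_ : _ = 0); last by rewrite /pr big_pred0 // => z; rewrite /= u0 andbF.
  by rewrite !mulr_ge0 ?invr_ge0 ?exprn_ge0.
have uJ' : u \notin J by apply/negP => /uJ; rewrite ltnn.
apply: (@le_trans _ _ (\sum_(j : V | (j < u)%N)
   Pr (fun z => prescribed (u |: J)%SET (prescribe x u j) finset.set0 z &&
                deep z.1 t j))).
  apply: (pr_le_sum m_ge0) => z mz /andP[Hp /= /andP[_ Hd]].
  exists (z.1 u); first exact: law_tree lawm _ mz _ u_gt0.
  by rewrite Hd andbT prescribedU1.
apply: (@le_trans _ _ (\sum_(j : V | (j < u)%N)
    ((\prod_(i in J) (i : nat)%:R^-1) * ((u : nat)%:R * 2 ^+ t)^-1) * j.+1%:R)).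
  apply: ler_sum => j ju.
  have Hx i : i \in (u |: J)%SET -> (prescribe x u j i < i)%N.
    rewrite in_setU1 /prescribe; have [->//|_ /= ] := eqVneq i u; exact: admJ.
  have Hj i : i \in (u |: J)%SET -> (j < i)%N.
    by rewrite in_setU1 => /predU1P[->//|/uJ]; exact: ltn_trans.
  apply: le_trans (IH _ _ _ Hx Hj) _; rewrite big_setU1 //=.
  by rewrite invfM le_eqVlt; apply/orP; left; apply/eqP; ring.
rewrite -mulr_sumr -mulrA; apply: ler_wpM2l => //.
have -> : \sum_(j : V | (j < u)%N) j.+1%:R = ((u : nat)%:R * u.+1%:R) / 2 :> R.
  rewrite (big_ord_narrow (F := fun j : V => j.+1%:R : R) (ltnW (ltn_ord u))) /=.
  elim: (nat_of_ord u) => [|k IHk]; first by rewrite big_ord0 !mul0r.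
  by rewrite big_ord_recr /= IHk -!natr1; field.
have un0 : (u : nat)%:R != 0 :> R by rewrite pnatr_eq0 -lt0n.
rewrite exprS le_eqVlt; apply/orP; left; apply/eqP.
by field; rewrite un0 expf_neq0.
Qed.

(** Complements of independent events are independent: expand the product of the
    indicators 1 - 1(e) and integrate term by term. *)
Lemma pr_no_extra (F : edge_set n.+1) : (forall e, e \in F -> #|e| = 2%N) ->
  Pr (fun z => [forall e in F, e \notin z.2]) = \prod_(e in F) (1 - extra_prob e).
Proof.
move=> F2.
pose s (e : {set V}) : R := if e \in F then -1 else 0.
have indE (z : outcome) : ([forall e in F, e \notin z.2])%:R =
    \prod_e (s e * (e \in z.2)%:R + 1) :> R.
  case: (boolP [forall e in F, e \notin z.2]) => [/forall_inP H|].
    rewrite big1 // => e _; rewrite /s; case: ifP => [/H/negPf ->|_].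
      by rewrite mulr0 add0r.
    by rewrite mul0r add0r.
  rewrite negb_forall_in => /exists_inP[e eF]; rewrite negbK => ez.
  by rewrite (bigD1 e) //= /s eF ez mulr1 addNr mul0r.
have expand (a : {set V} -> R) : \prod_e (s e * a e + 1) =
    \sum_(J in {set {set V}}) (\prod_(e in J) s e) * \prod_(e in J) a e.
  rewrite bigA_distr; apply: eq_bigr => J _.
  by rewrite -big_split /= [RHS]big_mkcond.
rewrite prE (eq_bigr _ (fun z _ => congr1 ( *%R (m z)) (indE z))).
under eq_bigr do rewrite expand mulr_sumr.
rewrite exchange_big /=.
have -> : \prod_(e in F) (1 - extra_prob e) = \prod_e (s e * extra_prob e + 1).
  rewrite big_mkcond; apply: eq_bigr => e _; rewrite /s.
  by case: ifP => _; rewrite ?mulN1r ?mul0r ?add0r // addrC.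
rewrite expand; apply: eq_bigr => J _.
under eq_bigr do rewrite mulrCA; rewrite -mulr_sumr.
have [JF|/fintype.subsetPn[e eJ eF]] := boolP (J \subset F); last first.
  by rewrite (bigD1 e) //= /s (negPf eF) !mul0r.
congr (_ * _).
have adm : admissible finset.set0 (fun i => i) J.
  by split=> e; rewrite ?inE // => /(fintype.subsetP JF); exact: F2.
have := law_prescribed lawm adm; rewrite big_set0 mul1r => <-.
rewrite prE; apply: eq_bigr => z _; congr (_ * _).
rewrite /prescribed.
have -> : [forall i in finset.set0, z.1 i == i] = true.
  by apply/forall_inP => i; rewrite inE.
have [/fintype.subsetP JZ|/fintype.subsetPn[e eJ ez]] /= := boolP (J \subset z.2).
  by rewrite big1 // => e /JZ ->.
by rewrite (bigD1 e) //= (negPf ez) mul0r.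
Qed.

End CooperFrieze.

(** * The root carries a short theta *)

Section RootCapture.
Variables (R : realType) (c : R) (n : nat).
Hypothesis c_gt0 : 0 < c.
Notation V := 'I_n.+1.
Variable m : outcome n -> R.
Hypothesis lawm : cooper_frieze_law c m.
Notation Pr := (pr m).
Let m_ge0 := law_ge0 lawm.

(** It is at least 1/2, so it also controls the events of probability O(2^(-k)). *)
Definition miss_rate : R := expR (- (Num.min c 1 / 2)).

Lemma miss_rate_ge_half : 2^-1 <= miss_rate.
Proof.
apply: le_trans (expR_ge1Dx _).
have : Num.min c 1 <= 1 by rewrite ge_min lexx orbT.
by move: (Num.min c 1) => b; lra.
Qed.

Lemma sum_block a b (F : nat -> R) : (b <= n)%N ->
  \sum_(u : V | (a < u <= b)%N) F u = \sum_(a.+1 <= j < b.+1) F j.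
Proof.
move=> bn; rewrite (big_nat_widenl _ 0) // (big_nat_widen _ _ n.+1) //.
by rewrite big_mkord; apply: eq_bigl => u; rewrite ltnS.
Qed.

Lemma root_pair_card (u : V) : (0 < u)%N -> #|[set ord0; u]%SET| = 2%N.
Proof.
by move=> u0; rewrite cards2 -(inj_eq val_inj) /= eq_sym -lt0n u0.
Qed.

(** The edges between the root and the block are absent independently, so the
    probability is at most exp(- min(c, 1) H) where H, the sum of 1 / u over the
    block, is at least k / 2. *)
Lemma pr_no_root_edge p k : (2 ^ (p + k) <= n)%N ->
  Pr (fun z => [forall u : V, (2 ^ p < u <= 2 ^ (p + k))%N ==>
                              ([set ord0; u]%SET \notin z.2)]) <= miss_rate ^+ k.
Proof.
move=> kn; pose A (u : V) := (2 ^ p < u <= 2 ^ (p + k))%N.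
have A_gt0 u : A u -> (0 < u)%N by case/andP=> H _; exact: leq_ltn_trans H.
pose F : edge_set n.+1 := [set [set ord0; u]%SET | u in [set u | A u]%SET]%SET.
have F2 e : e \in F -> #|e| = 2%N.
  by case/imsetP => u; rewrite inE => /A_gt0 /root_pair_card Hu ->.
apply: (@le_trans _ _ (Pr (fun z => [forall e in F, e \notin z.2]))).
  apply: (le_pr m_ge0) => z _ /forallP H; apply/forall_inP => e /imsetP[u].
  by rewrite inE => Au ->; exact: (implyP (H u) Au).
rewrite (pr_no_extra lawm F2) big_imset /=; last first.
  move=> u v; rewrite !inE => /A_gt0 u0 /A_gt0 v0 /setP/(_ u).
  rewrite !inE eqxx orbT => /esym/orP[]/eqP // E.
  by rewrite E in u0.
pose q := Num.min c 1.
have q0 : 0 < q by rewrite lt_min c_gt0 ltr01.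
apply: (@le_trans _ _ (\prod_(u in [set u | A u]%SET) expR (- (q * (u : nat)%:R^-1)))).
  apply: ler_prod => u; rewrite inE => /A_gt0 u0.
  rewrite subr_ge0 {1}/extra_prob ge_min lexx orbT /=.
  apply: le_trans (expR_ge1Dx _); rewrite lerD2l lerN2 /extra_prob larger_end_pair max0n.
  have u0' : 0 < (u : nat)%:R :> R by rewrite ltr0n.
  rewrite le_min ler_pM2r ?invr_gt0 // ler_pdivrMr // mul1r !ge_min lexx /=.
  by rewrite ler1n u0 orbT.
rewrite -expR_sum /miss_rate -expRM_natr ler_expR sumrN lerNl.
rewrite mulNr opprK -mulr_sumr -mulrA ler_pM2l //.
have -> : \sum_(u in [set u | A u]%SET) (u : nat)%:R^-1 =
          \sum_((2 ^ p).+1 <= j < (2 ^ (p + k)).+1) j%:R^-1 :> R.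
  rewrite -(sum_block _ (fun j => j%:R^-1)) //.
  by apply: eq_bigl => u; rewrite inE.
by rewrite mulrC; exact: sum_inv_dyadic.
Qed.

(** The parent of u is the root with probability 1 / u and the extra edge is
    present with probability at most c / u; the tail of the sum of 1 / u^2 is
    small. *)
Lemma pr_root_double_edge k :
  Pr (fun z => [exists u : V, [&& (2 ^ k < u)%N, z.1 u == ord0 &
                                  [set ord0; u]%SET \in z.2]]) <= c / 2 ^+ k.
Proof.
have k0 : (0 < 2 ^ k)%N by rewrite expn_gt0.
apply: (@le_trans _ _ (\sum_(u : V | (2 ^ k < u <= n)%N)
   Pr (prescribed [set u]%SET (fun=> ord0) [set [set ord0; u]%SET]%SET))).
  apply: (pr_le_sum m_ge0) => z _ /existsP[u /and3P[ku zu Hu]].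
  exists u; first by rewrite ku -ltnS ltn_ord.
  rewrite /prescribed finset.sub1set Hu andbT.
  by apply/forall_inP => i; rewrite inE => /eqP ->.
apply: (@le_trans _ _ (\sum_(u : V | (2 ^ k < u <= n)%N) c * ((u : nat)%:R ^+ 2)^-1)).
  apply: ler_sum => u /andP[ku _]; have u0 : (0 < u)%N by exact: leq_ltn_trans ku.
  have adm : admissible [set u]%SET (fun=> ord0 : V) [set [set ord0; u]%SET]%SET.
    split=> [i|e]; rewrite inE => /eqP -> //; exact: root_pair_card.
  apply: le_trans (pr_prescribed_le c_gt0 lawm adm) _.
  rewrite /prescribed_weight !big_set1 larger_end_pair max0n expr2 invfM.
  by rewrite le_eqVlt; apply/orP; left; apply/eqP; ring.
rewrite (sum_block _ (fun j => c * (j%:R ^+ 2)^-1)) // -mulr_sumr ler_pM2l //.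
by rewrite -natrX; exact: sum_inv_sqr.
Qed.

Lemma pr_deep_block N t : (N <= n)%N ->
  Pr (fun z => [exists u : V, (u <= N)%N && deep z.1 t u]) <=
  (N.+1 ^ 2)%:R / 2 ^+ t.
Proof.
move=> Nn.
apply: (@le_trans _ _ (\sum_(u : V | (u < N.+1)%N) Pr (fun z => deep z.1 t u))).
  apply: (pr_le_sum m_ge0) => z _ /existsP[u /andP[uN Hu]].
  by exists u.
apply: (@le_trans _ _ (\sum_(u : V | (u < N.+1)%N) N.+1%:R / 2 ^+ t)).
  apply: ler_sum => u uN.
  apply: (@le_trans _ _ (u.+1%:R / 2 ^+ t)); last first.
    by rewrite ler_pM2r ?invr_gt0 ?exprn_gt0 // ler_nat.
  have none (P : V -> bool) (i : V) : i \in finset.set0 -> P i by rewrite inE.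
  have := pr_deep_le lawm t (none (fun i => i < i)%N) (none (fun i => u < i)%N).
  rewrite big_set0 mul1r; apply: le_trans; apply: (le_pr m_ge0) => z _ ->.
  rewrite andbT /prescribed finset.sub0set andbT.
  by apply/forall_inP => i; rewrite inE.
have N1 : (N.+1 <= n.+1)%N by [].
rewrite (big_ord_narrow (F := fun=> N.+1%:R / 2 ^+ t) N1).
by rewrite sumr_const card_ord -[leLHS]mulr_natl mulrA -natrM.
Qed.

(** The four exceptional events are the absence of extra root edges in either
    block, an extra edge of the root parallel to a tree edge, and a deep vertex;
    outside of them [theta_root] applies. *)
Lemma pr_no_theta_root k : (2 ^ (3 * k) <= n)%N ->
  Pr (fun z => ~~ theta (7 * k) (union_graph z) ord0) <=
  (6 + c) * miss_rate ^+ k.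
Proof.
move=> kn; set r := miss_rate.
have kn2 : (2 ^ (k + k) <= n)%N by apply: leq_trans kn; rewrite leq_exp2l //; lia.
have E3 : (3 * k = 2 * k + k)%N by lia.
have kn3 : (2 ^ (2 * k + k) <= n)%N by rewrite -E3.
pose bad1 : pred (outcome n) := fun z => [forall u : V, (2 ^ k < u <= 2 ^ (k + k))%N
  ==> ([set ord0; u]%SET \notin z.2)].
pose bad2 : pred (outcome n) := fun z => [forall u : V,
  (2 ^ (2 * k) < u <= 2 ^ (2 * k + k))%N ==> ([set ord0; u]%SET \notin z.2)].
pose bad3 : pred (outcome n) := fun z => [exists u : V, [&& (2 ^ k < u)%N,
  z.1 u == ord0 & [set ord0; u]%SET \in z.2]].
pose bad4 : pred (outcome n) := fun z =>
  [exists u : V, (u <= 2 ^ (3 * k))%N && deep z.1 (7 * k) u].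
have half : 2^-1 ^+ k <= r ^+ k.
  by rewrite lerXn2r ?nnegrE ?invr_ge0 ?expR_ge0 // miss_rate_ge_half.
have P1 : Pr bad1 <= r ^+ k by exact: pr_no_root_edge.
have P2 : Pr bad2 <= r ^+ k by exact: pr_no_root_edge.
have P3 : Pr bad3 <= c * r ^+ k.
  apply: le_trans (pr_root_double_edge k) _.
  by rewrite ler_pM2l // -exprVn.
have P4 : Pr bad4 <= 4 * r ^+ k.
  apply: le_trans (pr_deep_block _ kn) _.
  apply: (@le_trans _ _ (4 * 2^-1 ^+ k)); last by rewrite ler_pM2l.
  rewrite ler_pdivrMr ?exprn_gt0 //.
  have -> : (7 * k = k + 6 * k)%N by lia.
  rewrite exprD mulrA exprVn mulfVK ?expf_neq0 //.
  have -> : 4 * 2 ^+ (6 * k) = ((2 * 2 ^ (3 * k)) ^ 2)%:R :> R.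
    have -> : (6 * k = 3 * k * 2)%N by lia.
    by rewrite natrX natrM natrX exprMn -exprM; congr (_ * _); rewrite -natrX.
  rewrite ler_nat leq_exp2r // mul2n -addnn -addn1 leq_add2l.
  by rewrite expn_gt0.
apply: (@le_trans _ _ (Pr bad1 + (Pr bad2 + (Pr bad3 + Pr bad4)))); last first.
  apply: le_trans (lerD P1 (lerD P2 (lerD P3 P4))) _.
  by rewrite le_eqVlt; apply/orP; left; apply/eqP; ring.
apply: (@le_trans _ _ (Pr bad1 + Pr (fun z => bad2 z || (bad3 z || bad4 z)))); last first.
  rewrite lerD2l; apply: (@le_trans _ _ (Pr bad2 + Pr (fun z => bad3 z || bad4 z))).
    exact: (prU m_ge0).
  by rewrite lerD2l; exact: (prU m_ge0).
apply: (prU m_ge0) => z mz; apply: contraNT; rewrite !negb_or => /and4P[].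
rewrite /bad1 negb_forall => /existsP[u]; rewrite negb_imply negbK => /andP[/andP[u1 u2] Hu].
rewrite /bad2 negb_forall => /existsP[v]; rewrite negb_imply negbK => /andP[/andP[v1 v2] Hv].
rewrite /bad3 /bad4 !negb_exists => /forallP not3 /forallP not4.
have v1' : (2 ^ k < v)%N.
  by apply: leq_ltn_trans v1; rewrite leq_exp2l // leq_pmull.
have u2' : (u <= 2 ^ (3 * k))%N.
  by apply: leq_trans u2 _; rewrite leq_exp2l // addnn -mul2n leq_mul2r orbT.
have v2' : (v <= 2 ^ (3 * k))%N by rewrite E3.
have par_gt0 (x : V) : (2 ^ k < x)%N -> [set ord0; x]%SET \in z.2 -> (0 < z.1 x)%N.
  move=> kx Hx; have := not3 x; rewrite kx Hx andbT /= lt0n.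
  by apply: contraNneq => E; apply/eqP/val_inj.
have shallow (x : V) : (x <= 2 ^ (3 * k))%N -> ~~ deep z.1 (7 * k) x.
  by move=> xk; have := not4 x; rewrite xk.
have gt0 (x : V) a : (2 ^ a < x)%N -> (0 < x)%N by exact: leq_ltn_trans.
apply: (@theta_root _ z.1 _ _ _ u v) => //.
- exact: law_tree lawm _ mz.
- move=> i i0; rewrite finset.in_setU; apply/orP; left.
  by apply/imsetP; exists i; rewrite ?inE.
- by rewrite finset.in_setU Hu orbT.
- by rewrite finset.in_setU Hv orbT.
- exact: par_gt0.
- exact: par_gt0.
- exact: gt0 u1.
- exact: gt0 v1.
- apply/eqP => uv; move: v1; rewrite -uv ltnNge (leq_trans u2) //.
  by rewrite leq_exp2l // mul2n addnn.
- exact: shallow.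
- exact: shallow.
Qed.

Lemma pr_root_missed k K : (2 ^ (3 * k) <= n)%N ->
  Pr (fun z => ord0 \notin theta_rule (7 * k) K (union_graph z)) <=
  (6 + c) * miss_rate ^+ k +
  9 * (8 * (8 * (1 + c)) ^+ 3) ^+ (7 * k) / K.+1%:R.
Proof.
move=> kn.
apply: le_trans (lerD (pr_no_theta_root kn) (lexx _)).
pose big : pred (outcome n) := fun z =>
  (K < #|[set v | theta (7 * k) (union_graph z) v]%SET|)%N.
apply: (@le_trans _ _ (Pr (fun z => ~~ theta (7 * k) (union_graph z) ord0) + Pr big)).
  apply: (prU m_ge0) => z _; rewrite /theta_rule /big ltnNge.
  by case: ifP => [_|]; rewrite !inE ?orbF ?orbT.
rewrite lerD2l ler_pdivlMr // mulrC.
apply: le_trans (pr_card_gt m_ge0 (fun v z => theta (7 * k) (union_graph z) v) K) _.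
exact: sum_pr_theta_le.
Qed.

End RootCapture.

(** * From random variables to a finite law *)

Section DiscreteLaw.
Variables (R : realType) (d : measure_display) (T : measurableType d).
Variable P : probability T R.
Local Open Scope classical_set_scope.

Lemma random_element_points (O : finType) (Z : T -> O) :
  (forall z, measurable (Z @^-1` [set z])) -> random_element Z.
Proof.
move=> mZ B; have -> : Z @^-1` B = \bigcup_(z in B) Z @^-1` [set z].
  by apply/seteqP; split=> w /= => [Bw|[z Bz /= ->] //]; exists (Z w).
by apply: fin_bigcup_measurable => // z _; exact: mZ.
Qed.

Definition point_mass (O : finType) (Z : T -> O) (z : O) : R :=
  fine (P (Z @^-1` [set z])).

Lemma pr_point_mass (O : finType) (Z : T -> O) (A : pred O) :
  random_element Z -> P [set w | A (Z w)] = (pr (point_mass Z) A)%:E.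
Proof.
move=> mZ.
have -> : [set w | A (Z w)] = \bigcup_(z in [set` A]) Z @^-1` [set z].
  by apply/seteqP; split=> w /= => [Aw|[z Az /= ->] //]; exists (Z w).
rewrite measure_fin_bigcup //; last by move=> z1 z2 _ _ [w [/= <- <-]].
rewrite -(@bigfs _ _ _ _ (index_enum O) A) ?index_enum_uniq //; last by move=> z _; rewrite mem_index_enum.
rewrite /pr -sumEFin; apply: eq_bigr => z _.
by rewrite /point_mass fineK // fin_num_measure.
Qed.

End DiscreteLaw.

Section CooperFriezeLaw.
Variables (R : realType) (d : measure_display) (T : measurableType d).
Variable P : probability T R.
Local Open Scope classical_set_scope.

(** The parent function is recovered from the tree, because {i, j} with j < i is a
    tree edge exactly when j is the parent of i; so the independence of the two
    edge sets makes the parents and the extra edges independent. *)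
Lemma cooper_frieze_has_law (c : R) (n : nat) (G : T -> edge_set n.+1) :
  uniform_cooper_frieze P c G ->
  exists m, cooper_frieze_law c m /\
    forall A : pred (edge_set n.+1),
      P [set w | A (G w)] = (pr m (fun z => A (union_graph z)))%:E.
Proof.
move=> [G1 [G2 [[X [mX indX ltX PX G1E]] [mG2 _ indG2 PG2] indG GE]]].
pose Z w : outcome n := ([ffun i => X i w], G2 w).
have treeE w : tree_edges (Z w).1 = G1 w.
  by rewrite G1E; apply: eq_imset => i; rewrite /= ffunE.
have lt_tree w (i : 'I_n.+1) : (0 < i)%N -> ((Z w).1 i < i)%N.
  by move=> i0; rewrite ffunE; exact: ltX.
have mZ : random_element Z.
  apply: random_element_points => z.
  have -> : Z @^-1` [set z] =
      (\bigcap_(i in [set: 'I_n.+1]) X i @^-1` [set z.1 i]) `&` G2 @^-1` [set z.2].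
    apply/seteqP; split=> w /=.
      by move=> <-; split=> // i _ /=; rewrite ffunE.
    move=> [H1 H2]; rewrite [z]surjective_pairing -H2; congr (_, _).
    by apply/ffunP => i; rewrite ffunE; exact: H1.
  apply: measurableI; last exact: mG2.
  by apply: fin_bigcap_measurable => // i _; exact: mX.
exists (point_mass P Z); split; last first.
  move=> A; rewrite -(pr_point_mass _ (fun z => A (union_graph z)) mZ).
  by congr (P _); apply/seteqP; split=> w /=; rewrite /union_graph treeE GE.
split.
- by move=> z; rewrite fine_ge0.
- apply: EFin_inj; have := pr_point_mass P predT mZ; rewrite /pr => <-.
  by rewrite -[RHS](probability_setT P); congr (P _); apply/seteqP; split.
- move=> z mz i i0.
  have [[w <-]|Zz] := pselect (exists w, Z w = z); first exact: lt_tree.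
  move: mz; rewrite /point_mass (_ : _ @^-1` _ = set0) ?measure0 ?eqxx //.
  by apply/seteqP; split=> w //= Zw; apply: Zz; exists w.
move=> J x F [admJ admF]; apply: EFin_inj; rewrite -(pr_point_mass _ _ mZ).
have -> : [set w | prescribed J x F (Z w)] =
    G1 @^-1` [set H : edge_set n.+1 | forall i, i \in J -> [set i; x i]%SET \in H] `&`
    G2 @^-1` [set H : edge_set n.+1 | F \subset H].
  apply/seteqP; split=> w /=.
    move=> /andP[/forall_inP HJ HF]; split=> // i iJ.
    by rewrite -treeE (mem_tree_edges (lt_tree w) (admJ _ iJ)); exact: HJ.
  move=> [HJ HF]; rewrite /prescribed HF andbT; apply/forall_inP => i iJ.
  by have := HJ i iJ; rewrite -treeE (mem_tree_edges (lt_tree w) (admJ _ iJ)).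
rewrite indG EFinM; congr (_ * _)%E.
- have -> : G1 @^-1` [set H : edge_set n.+1 | forall i, i \in J -> [set i; x i]%SET \in H] =
      \bigcap_(i in [set` J]) X i @^-1` [set x i].
    apply/seteqP; split=> w /= H i /= iJ; have := H i iJ.
      rewrite -treeE (mem_tree_edges (lt_tree w) (admJ _ iJ)) ffunE.
      by move/eqP.
    rewrite -treeE (mem_tree_edges (lt_tree w) (admJ _ iJ)) ffunE => ->.
    exact: eqxx.
  rewrite indX; last first.
    by apply/fintype.subsetP => i /admJ xi; rewrite inE (leq_ltn_trans _ xi).
  by rewrite -prodEFin; apply: eq_bigr => i /admJ; exact: PX.
have -> : G2 @^-1` [set H : edge_set n.+1 | F \subset H] =
    \bigcap_(e in [set` F]) [set w | e \in G2 w].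
  apply/seteqP; split=> w /= H.
    by move=> e /= eF; exact: (fintype.subsetP H).
  by apply/fintype.subsetP => e; exact: H.
rewrite indG2; last by apply/fintype.subsetP => e /admF; rewrite inE => ->.
rewrite -prodEFin; apply: eq_bigr => e /admF/eqP/cards2P[i] [j] [ij ->].
by rewrite PG2 // /extra_prob larger_end_pair.
Qed.

(** With at most K vertices all of them are taken; otherwise the vertices up to
    2^(3k) exist and [pr_root_missed] applies. *)
Lemma confidence_set_of_size (c : R) (n : nat) (G : T -> edge_set n.+1)
    (eps : R) (k K : nat) : 0 < c -> uniform_cooper_frieze P c G ->
  (6 + c) * miss_rate c ^+ k <= eps / 2 ->
  9 * (8 * (8 * (1 + c)) ^+ 3) ^+ (7 * k) <= eps / 2 * K.+1%:R ->
  (2 ^ (3 * k) <= K)%N ->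
  root_confidence_set P G eps K.
Proof.
move=> c_gt0 /cooper_frieze_has_law[m [lawm PE]] miss many Kk.
have m_ge0 := law_ge0 lawm; have m_sum1 := law_sum1 lawm.
have eps0 : 0 <= eps.
  have miss0 : 0 <= (6 + c) * miss_rate c ^+ k.
    by rewrite mulr_ge0 ?exprn_ge0 ?expR_ge0 // addr_ge0 // ltW.
  by have := le_trans miss0 miss; rewrite pmulr_lge0.
have [nK|nK] := leqP n.+1 K.
  exists (fun=> finset.setT); split=> [H pi _|H _|].
  - apply/setP => v; rewrite [RHS](_ : _ = true) ?inE //.
    by apply/imsetP; exists (pi^-1 v)%g; rewrite ?inE ?permKV.
  - by rewrite cardsT card_ord.
  rewrite (PE (fun H => ord0 \in finset.setT)) lee_fin.
  rewrite /pr (eq_bigl predT) => [|z]; last by rewrite inE.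
  by rewrite m_sum1 gerBl.
exists (theta_rule (7 * k) K); split=> [|H _|].
- exact: label_free_theta_rule.
- exact: card_theta_rule.
rewrite (PE (fun H => ord0 \in theta_rule (7 * k) K H)) lee_fin.
have kn : (2 ^ (3 * k) <= n)%N by rewrite -ltnS (leq_ltn_trans Kk).
have := pr_root_missed c_gt0 lawm K kn.
rewrite (prC _ m_sum1) => missed; rewrite lerBlDr -lerBlDl.
apply: le_trans missed _; rewrite [leRHS](splitr eps); apply: lerD => //.
by rewrite ler_pdivrMr.
Qed.

End CooperFriezeLaw.

(** * Choice of the parameters *)

(** After taking logarithms this is L <= 1 + L ln L, that is ln (1 / L) <= 1 / L - 1. *)
Lemma expR_le_powR_self (R : realType) (B L : R) : 0 <= B -> 0 < L ->
  expR (B * L) <= expR B * L `^ (B * L).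
Proof.
move=> B0 L0; rewrite /powR gt_eqF // -expRD ler_expR.
have H : - ln L <= L^-1 - 1.
  rewrite -lnV ?posrE // -[X in ln X](subrK 1) addrC; apply: le_ln1Dx.
  by rewrite ltrBrDl subrr invr_gt0.
have : L * (- ln L) <= L * (L^-1 - 1) by rewrite ler_pM2l.
rewrite mulrBr mulfV ?gt_eqF // mulr1 mulrN => {}H.
have -> : B + B * L * ln L = B * (1 + L * ln L) by ring.
by rewrite ler_wpM2l //; lra.
Qed.

(** Take k just above x = (L + ln D) / lam with D = 2 (6 + c), L = ln (1 / eps) and
    exp(- lam) the miss rate, then K just large enough for Markov's inequality.
    Both are of the form exp(O(L + 1)). *)
Lemma quasi_polynomial_size (R : realType) (c : R) : 0 < c ->
  exists c0 c1 : R, [/\ 0 < c0, 0 < c1 &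
    forall eps : R, 0 < eps < 1 -> exists k K : nat,
      [/\ (6 + c) * miss_rate c ^+ k <= eps / 2,
          9 * (8 * (8 * (1 + c)) ^+ 3) ^+ (7 * k) <= eps / 2 * K.+1%:R,
          (2 ^ (3 * k) <= K)%N &
          K%:R <= c0 * (ln (1 / eps) `^ (c1 * ln (1 / eps)))]].
Proof.
move=> c_gt0; pose lam : R := Num.min c 1 / 2.
have lam0 : 0 < lam by rewrite divr_gt0 // lt_min c_gt0 ltr01.
pose A : R := (8 * (8 * (1 + c)) ^+ 3) ^+ 7.
have C1 : 1 <= 8 * (1 + c) by move: c_gt0; lra.
(* A >= 8 ensures 2^(3k) <= K. *)
have A8 : 8 <= A.
  have base8 : 8 <= 8 * (8 * (1 + c)) ^+ 3 by rewrite ler_peMr // exprn_ege1.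
  have base1 : 1 <= 8 * (8 * (1 + c)) ^+ 3 by rewrite (le_trans _ base8) // ler1n.
  by rewrite /A (le_trans base8) // ler_eXnr.
have A1 : 1 <= A by rewrite (le_trans _ A8) // ler1n.
have A0 : 0 < A by exact: lt_le_trans A1.
have lnA0 : 0 <= ln A by rewrite ln_ge0.
pose D : R := 2 * (6 + c).
have D1 : 1 <= D by rewrite /D; move: c_gt0; lra.
have D0 : 0 < D by exact: lt_le_trans D1.
pose beta := ln A / lam.
have beta0 : 0 <= beta by rewrite divr_ge0 // ltW.
pose alpha := ln A * (ln D / lam + 1).
exists (18 * expR alpha * expR (beta + 1)), (beta + 1); split.
- by rewrite !mulr_gt0 ?expR_gt0.
- by rewrite ltr_wpDl.
move=> eps /andP[eps0 eps1]; set L := ln (1 / eps).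
have L0 : 0 < L by rewrite /L div1r ln_gt0 // invf_gt1.
have expL : expR L = eps^-1 by rewrite /L div1r lnK // posrE invr_gt0.
pose x := (L + ln D) / lam.
have x0 : 0 <= x by rewrite divr_ge0 ?(ltW lam0) // addr_ge0 ?(ltW L0) // ln_ge0.
pose k := (Num.truncn x).+1.
have xk : x < k%:R by exact: truncnS_gt.
have kx : k%:R <= x + 1 by rewrite -natr1 lerD2r truncn_le.
(* Markov's inequality asks for 9 A^k / (K + 1) <= eps / 2, and 1 / eps = e^L. *)
pose y := 18 * A ^+ k * expR L.
have Ak0 : 0 < A ^+ k by rewrite exprn_gt0.
have y0 : 0 <= y by rewrite !mulr_ge0 ?expR_ge0 // ltW.
exists k, (Num.truncn y); split.
- rewrite /miss_rate -/lam -expRM_natr.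
  apply: (@le_trans _ _ ((6 + c) * expR (- (L + ln D)))).
    rewrite ler_pM2l ?addr_gt0 // ler_expR mulNr lerN2.
    by rewrite mulrC -ler_pdivrMr // ltW.
  rewrite expRN expRD expL lnK ?posrE // /D.
  rewrite le_eqVlt; apply/orP; left; apply/eqP; field.
  by rewrite !lt0r_neq0 // addr_gt0.
- rewrite exprM -/A.
  have : y <= (Num.truncn y).+1%:R by rewrite ltW // truncnS_gt.
  rewrite -(ler_pM2l (_ : 0 < eps / 2)) ?divr_gt0 //; apply: le_trans.
  rewrite /y expL; move: (A ^+ k) => a.
  rewrite le_eqVlt; apply/orP; left; apply/eqP; field.
  by rewrite lt0r_neq0.
- rewrite truncn_ge_nat // expnM natrX /y.
  have Ak : (2 ^ 3)%:R ^+ k <= A ^+ k by rewrite lerXn2r ?nnegrE ?(ltW A0).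
  apply: le_trans Ak _; rewrite -mulrA mulrCA ler_peMr ?(ltW Ak0) //.
  have : 1 <= expR L by rewrite expL invf_ge1 // ltW.
  by move: (expR L) => e; clear; lra.
apply: (@le_trans _ _ y); first by rewrite truncn_le.
apply: (@le_trans _ _ (18 * expR alpha * expR ((beta + 1) * L))); last first.
  rewrite -[leRHS]mulrA ler_pM2l ?mulr_gt0 ?expR_gt0 //.
  by apply: expR_le_powR_self => //; rewrite addr_ge0.
rewrite /y -!mulrA ler_pM2l // mulrDl mul1r expRD mulrA.
rewrite ler_pM2r ?expR_gt0 // -{1}[A]lnK ?posrE // -expRM_natr -expRD ler_expR.
apply: (@le_trans _ _ (ln A * (x + 1))); first by rewrite ler_wpM2l.
rewrite le_eqVlt; apply/orP; left; apply/eqP; rewrite /alpha /beta /x.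
by field; rewrite lt0r_neq0.
Qed.

Theorem theorem2 (R : realType) (c : R) (hc : 0 < c) :
  exists c0 c1 : R, [/\ 0 < c0, 0 < c1 &
    forall (d : nat -> measure_display) (T : forall m, measurableType (d m))
      (P : forall m, probability (T m) R)
      (G : forall m, T m -> edge_set m.+1),
      (forall m, uniform_cooper_frieze (P m) c (@G m)) ->
      root_estimation_possible P G /\
      exists K : R -> nat,
        root_estimation_with P G K /\
        forall eps : R, 0 < eps < 1 ->
          (K eps)%:R <= c0 * (ln (1 / eps) `^ (c1 * ln (1 / eps)))].
Proof.
have [c0 [c1 [c0_gt0 c1_gt0 sizes]]] := quasi_polynomial_size hc.
exists c0, c1; split=> // d T P G cfG.
suff [K [KP Kle]] : exists K : R -> nat, root_estimation_with P G K /\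
    forall eps : R, 0 < eps < 1 ->
      (K eps)%:R <= c0 * (ln (1 / eps) `^ (c1 * ln (1 / eps))).
  by split; exists K.
have /choice[K HK] : forall eps : R, exists K : nat, 0 < eps < 1 -> exists k : nat,
      [/\ (6 + c) * miss_rate c ^+ k <= eps / 2,
          9 * (8 * (8 * (1 + c)) ^+ 3) ^+ (7 * k) <= eps / 2 * K.+1%:R,
          (2 ^ (3 * k) <= K)%N &
          K%:R <= c0 * (ln (1 / eps) `^ (c1 * ln (1 / eps)))].
  move=> eps; have [/sizes[k [K H]]|_] := boolP (0 < eps < 1); last by exists 0%N.
  by exists K => _; exists k.
exists K; split=> eps /HK[k [miss many kK Kle]] //; split.
  by apply: leq_trans kK; rewrite expn_gt0.
move=> m; exact: confidence_set_of_size hc (cfG m) miss many kK.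
Qed.
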